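(* Let $x,x_1,x_2$ be roots of unity and $p_1,p_2,q\ge1$ integers with $(p_1,x_1),(p_2,x_2),(q,xx_1x_2)\neq(1,1)$. Write $X=xx_1x_2$ and let $\sum_\sigma$ denote the sum over $\sigma\in\{(1,2),(2,1)\}$, i.e. $\sum_\sigma f(\sigma(1),\sigma(2))=f(1,2)+f(2,1)$. Then \begin{align*} &(x_1x_2)^{-1}\tilde S_{p_1,p_2;q}\big(x_1,x_2;X^{-1}\big)+(-1)^{p_1+p_2+q}\tilde S_{p_1,p_2;q}\big(x_1^{-1},x_2^{-1};X\big)\\ &=-(x_1x_2)^{-1}\mathrm{ti}_{p_1}(x_1)\mathrm{ti}_{p_2}(x_2)\mathrm{Li}_q(X^{-1})-(-1)^q(x_1x_2)^{-1}\mathrm{ti}_{p_1}(x_1)\mathrm{ti}_{p_2}(x_2)\mathrm{Li}_q(X)\\ &\quad+\sum_\sigma(x_1x_2)^{-1}\mathrm{ti}_{p_{\sigma(1)}}(x_{\sigma(1)})\tilde S_{p_{\sigma(2)};q}\big(x_{\sigma(2)};X^{-1}\big)\\ &\quad-(-1)^q\sum_\sigma(-1)^{p_{\sigma(2)}}x_{\sigma(1)}^{-1}\mathrm{ti}_{p_{\sigma(1)}}(x_{\sigma(1)})\tilde S_{p_{\sigma(2)};q}\big(x_{\sigma(2)}^{-1};X\big)\\ &\quad-(-1)^qX^{-1}\sum_{k=0}^{p_1+p_2-1}\binom{p_1+p_2+q-k-2}{q-1}\Big((-1)^k\mathrm{ti}_{k+1}(x)-x\,\mathrm{ti}_{k+1}(x^{-1})\Big)\mathrm{ti}_{p_1+p_2+q-k-1}(X)\\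 &\quad-(-1)^q\sum_\sigma\sum_{\substack{k_1,k_2\ge0\\k_1+k_2\le p_{\sigma(1)}-1}}\binom{p_{\sigma(1)}+q-k_1-k_2-2}{q-1}\binom{k_2+p_{\sigma(2)}-1}{p_{\sigma(2)}-1}\Big((-1)^{k_1}\mathrm{ti}_{k_1+1}(x)-x\,\mathrm{ti}_{k_1+1}(x^{-1})\Big)\\ &\qquad\times\Big\{(-1)^{k_2}X^{-1}\mathrm{Li}_{k_2+p_{\sigma(2)}}(x_{\sigma(2)})\mathrm{ti}_{q+p_{\sigma(1)}-k_1-k_2-1}(X)+(-1)^{p_{\sigma(2)}}R_{k_2+p_{\sigma(2)};q+p_{\sigma(1)}-k_1-k_2-1}\big(x_{\sigma(2)}^{-1};X\big)\Big\}\\ &\quad-\sum_{\substack{k_1+k_2=q\\k_1,k_2\ge0}}(-1)^q\binom{p_1+k_1-1}{p_1-1}\binom{p_2+k_2-1}{p_2-1}(x_1x_2)^{-1}\mathrm{ti}_{p_1+k_1}(x_1)\mathrm{ti}_{p_2+k_2}(x_2)\\ &\quad-\sum_{\substack{k_1+k_2+k_3=q-1\\k_1,k_2,k_3\ge0}}\Big((-1)^{k_1}\mathrm{Li}_{k_1+1}(x)-\mathrm{Li}_{k_1+1}(x^{-1})\Big)(-1)^{k_2+k_3}\binom{k_2+p_1-1}{p_1-1}\binom{k_3+p_2-1}{p_2-1}\mathrm{ti}_{k_2+p_1}(x_1)\mathrm{ti}_{k_3+p_2}(x_2)(x_1x_2)^{-1}. \end{align*}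
   Context: For $p\in\mathbb{N}$, $n\ge0$, root of unity $z$: $\zeta_n(p;z)=\sum_{k=1}^n z^k/k^p$ and $t_n(p;z)=\sum_{k=1}^n z^k/(k-1/2)^p$ (empty sums $0$). For $|z|\le1$, $(m,z)\ne(1,1)$: $\mathrm{Li}_m(z)=\sum_{n\ge1}z^n/n^m$, $\mathrm{ti}_m(z)=\sum_{n\ge1}z^n/(n-1/2)^m$. For positive integers $p_1,\ldots,p_k,q$ and roots of unity $z_1,\ldots,z_k,z$ with $(q,z)\ne(1,1)$: $\tilde S_{p_1,\ldots,p_k;q}(z_1,\ldots,z_k;z)=\sum_{n\ge1}\frac{t_n(p_1;z_1)\cdots t_n(p_k;z_k)}{n^q}z^n$ and $R_{p_1,\ldots,p_k;q}(z_1,\ldots,z_k;z)=\sum_{n\ge0}\frac{\zeta_n(p_1;z_1)\cdots\zeta_n(p_k;z_k)}{(n+1/2)^q}z^n$. *)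

(* Defs.v *)
From mathcomp Require Import all_boot all_order all_algebra.
From mathcomp Require Import all_classical all_reals all_analysis.
From mathcomp Require Import complex.

Set Implicit Arguments.
Unset Strict Implicit.
Unset Printing Implicit Defensive.

Import Order.TTheory GRing.Theory Num.Theory.
Import numFieldNormedType.Exports.

Local Open Scope classical_set_scope.
Local Open Scope ring_scope.
Local Open Scope complex_scope.

Section Definitions.
Variable R : realType.
Implicit Types (z : R[i]) (n p q m : nat) (pzs : seq (nat * R[i])).

(* n > 0 is essential: every z is a 0.-unity_root. *)
Definition is_root_of_unity z : Prop := exists2 n, (0 < n)%N & n.-unity_root z.

(* \sum_(n >= n0) u n as the limit of the partial sums, in the order of
   summation and for the topology given by the modulus (several of the series
   below converge only conditionally). The cast selects the topology that every
   numFieldType carries. If the series diverges the value is an arbitrary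
   constant; thus ti 1 1 - ti 1 1 = 0 and Li 1 1 - Li 1 1 = 0. *)
Definition csum (n0 : nat) (u : nat -> R[i]) : R[i] :=
  limn (fun N => \sum_(n0 <= n < N) u n : (R[i] : numFieldType)).

Definition zetan n p z : R[i] := \sum_(1 <= k < n.+1) z ^+ k / k%:R ^+ p.

Definition tn n p z : R[i] :=
  \sum_(1 <= k < n.+1) z ^+ k / (k%:R - 2^-1) ^+ p.

Definition Li m z : R[i] := csum 1 (fun n => z ^+ n / n%:R ^+ m).

Definition ti m z : R[i] := csum 1 (fun n => z ^+ n / (n%:R - 2^-1) ^+ m).

(* In Stilde and Rsum the list pzs is [:: (p_1, z_1); ...; (p_k, z_k)]. *)
Definition Stilde pzs q z : R[i] :=
  csum 1 (fun n => (\prod_(pz <- pzs) tn n pz.1 pz.2) / n%:R ^+ q * z ^+ n).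

Definition Rsum pzs q z : R[i] :=
  csum 0 (fun n =>
    (\prod_(pz <- pzs) zetan n pz.1 pz.2) / (n%:R + 2^-1) ^+ q * z ^+ n).

(* f takes p_{sigma(1)}, x_{sigma(1)}, p_{sigma(2)}, x_{sigma(2)}. *)
Definition sum_sigma (p1 : nat) (x1 : R[i]) (p2 : nat) (x2 : R[i])
    (f : nat -> R[i] -> nat -> R[i] -> R[i]) : R[i] :=
  f p1 x1 p2 x2 + f p2 x2 p1 x1.

End Definitions.

(* Main.v *)
Require Import Defs.
From mathcomp Require Import all_boot all_order all_algebra.
From mathcomp Require Import all_classical all_reals all_analysis.
From mathcomp Require Import complex.
From mathcomp Require Import ring zify lra.

Set Implicit Arguments.
Unset Strict Implicit.
Unset Printing Implicit Defensive.

Import Order.TTheory GRing.Theory Num.Theory.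
Import numFieldNormedType.Exports.
Local Open Scope ring_scope.
Local Open Scope complex_scope.

(* Truncate Phi_p(s; z) = sum_(k >= 1) z^k / (s + k - 1/2)^p at k <= M and let
   A(N, M) be the sum over 0 < |n| <= N of x^-n Phi_p1(n; x_1) Phi_p2(n; x_2) / n^q.
   At integers Phi is elementary, e.g. Phi_p(n; z) = z^-n (ti_p(z) - t_n(p; z)) for
   n >= 0, so that letting M, then N, go to infinity gives the terms of the theorem
   with S~_{p1,p2;q}, S~_{p;q} and Li_q(X^{+-1}).  On the other hand, for finite N
   and M the partial fraction decomposition of (s + a)^-p1 (s + b)^-p2 s^-q, with
   half-integers a and b, expresses A(N, M) through sums of x^-n / (n + a)^r and
   x^-n / n^r; letting first N and then M go to infinity produces the remaining terms
   (the poles -a with a <> b give Li and R, those with a = b give the single sum,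
   the pole 0 gives the last two sums).  The two limits agree because the tails of
   ti and Li are O(1/n), so that the error is bounded by
   sum_(1 <= n <= M) 1 / (n (M + 1 - n)) + 1 / (M + 1). *)

(** One obstacle is conditional convergence: [p1], [p2] and [q] may all be 1, so the limits cannot
    be exchanged by domination. A rate takes its place: at every admissible argument the partial
    sums approach their limit with error O(1/n), by comparison for exponents at least 2 and by Abel
    summation for exponent 1, and this rate survives products. The other obstacle is that x = 1 is
    allowed, where ti_1(x) and Li_1(x) diverge. The sums over n are therefore kept symmetric, n
    being paired with -n. For x = 1 and exponent 1 they tend to 0, and the combinations ti_1(1) -
    ti_1(1) and Li_1(1) - Li_1(1) of the theorem are also 0, whatever value [csum] gives to a
    divergent series. Partial fractions of finite sums play the part of the residue theorem; the
    coefficients are handled through recurrences of Taylor coefficients. *)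

(** * Partial fractions and Taylor coefficients of products of inverse powers *)

Section PartialFractions.
Variable F : fieldType.
Implicit Types (a b w : F) (p q r i j k n : nat).

(* The coefficient of s^i in the Taylor expansion of (s + a)^-p at s = 0. *)
Definition taylor_inv a p i : F := (-1) ^+ i * 'C(p + i - 1, i)%:R / a ^+ (p + i).

Lemma taylor_inv0 a i : taylor_inv a 0 i = (i == 0%N)%:R.
Proof.
case: i => [|i]; first by rewrite /taylor_inv expr0 bin0 !mul1r invr1.
by rewrite /taylor_inv add0n subn1 /= bin_small // mulr0 mul0r.
Qed.

Lemma taylor_inv_rec0 a p : a != 0 -> a * taylor_inv a p.+1 0 = taylor_inv a p 0.
Proof.
move=> a0; rewrite /taylor_inv !addn0 !bin0 !expr0 !mul1r exprS.
by rewrite invfM mulrA divff // mul1r.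
Qed.

Lemma taylor_inv_rec a p i : a != 0 ->
  a * taylor_inv a p.+1 i.+1 + taylor_inv a p.+1 i = taylor_inv a p i.+1.
Proof.
move=> a0; rewrite /taylor_inv.
have -> : (p.+1 + i.+1 - 1 = (p + i).+1)%N by lia.
have -> : (p + i.+1 - 1 = p + i)%N by lia.
have -> : (p.+1 + i - 1 = p + i)%N by lia.
have -> : (p.+1 + i.+1 = (p + i).+2)%N by lia.
have -> : (p.+1 + i = (p + i).+1)%N by lia.
have -> : (p + i.+1 = (p + i).+1)%N by lia.
by rewrite binS natrD !exprS; field; rewrite expf_neq0 ?a0.
Qed.

(** As w is invertible, the recurrence determines [G] from its values on the two axes, and the
    right-hand side obeys the same recurrence. The model is G p r = (s + a)^-p (s + b)^-r with w = b
    - a. Keeping [G] abstract allows a second use, on the Taylor coefficients of that function. *)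
Lemma partial_fractions w (G : nat -> nat -> F) : w != 0 ->
  (forall p r, w * G p.+1 r.+1 = G p.+1 r - G p r.+1) ->
  forall p r, (0 < p + r)%N ->
  G p r = \sum_(k < p) taylor_inv w r k * G (p - k)%N 0%N
        + \sum_(k < r) taylor_inv (- w) p k * G 0%N (r - k)%N.
Proof.
move=> w0 recG.
have w0' : - w != 0 by rewrite oppr_eq0.
have base (f : nat -> F) p : (0 < p)%N ->
  \sum_(k < p) (k == 0%N :> nat)%:R * f (p - k)%N = f p.
  case: p => // p _; rewrite big_ord_recl /= mul1r subn0 big1 ?addr0 // => k _.
  by rewrite mul0r.
(* shifting the index turns the two sums of the recurrence into one *)
have step v (f : nat -> F) p r : v != 0 ->
    v * \sum_(k < p.+1) taylor_inv v r.+1 k * f (p.+1 - k)%N =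
    \sum_(k < p.+1) taylor_inv v r k * f (p.+1 - k)%N
    - \sum_(k < p) taylor_inv v r.+1 k * f (p - k)%N.
  move=> v0; rewrite !big_ord_recl mulrDr mulrA taylor_inv_rec0 // -addrA.
  congr (_ + _); rewrite -sumrB mulr_sumr; apply: eq_bigr => k _ /=.
  by rewrite /bump /= add1n subSS -(taylor_inv_rec r) //; ring.
move=> p r; move: {2}(p + r)%N (leqnn (p + r)) => m.
elim: m p r => [|m IH] [|p] [|r] // hm _.
- rewrite big_ord0 add0r; under eq_bigr do rewrite taylor_inv0.
  by rewrite (base (G 0%N)).
- rewrite big_ord0 addr0; under eq_bigr do rewrite taylor_inv0.
  by rewrite (base (fun k => G k 0%N)).
apply: (mulfI w0); rewrite recG IH ?IH //; try lia.
rewrite mulrDr (step w (fun k => G k 0%N)) //.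
have := step (- w) (G 0%N) r p w0'; rewrite mulNr => /eqP.
rewrite eqr_oppLR => /eqP ->; ring.
Qed.

(** The coefficient of s^n in the Taylor expansion of (s + a)^-p (s + b)^-r at s = 0, as a Cauchy
    product. *)
Definition taylor_conv a b p r n : F :=
  \sum_(i < n.+1) taylor_inv a p i * taylor_inv b r (n - i).

Lemma taylor_convC a b p r n : taylor_conv a b p r n = taylor_conv b a r p n.
Proof.
rewrite /taylor_conv (reindex_inj rev_ord_inj) /=; apply: eq_bigr => i _.
by rewrite mulrC subSS subKn // -ltnS.
Qed.

Lemma taylor_conv_rec0 a b p r : b != 0 ->
  b * taylor_conv a b p r.+1 0 = taylor_conv a b p r 0.
Proof.
by move=> b0; rewrite /taylor_conv !big_ord1 mulrCA taylor_inv_rec0.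
Qed.

Lemma taylor_conv_rec a b p r n : b != 0 ->
  b * taylor_conv a b p r.+1 n.+1 + taylor_conv a b p r.+1 n
  = taylor_conv a b p r n.+1.
Proof.
move=> b0; rewrite /taylor_conv [in LHS]big_ord_recr [in RHS]big_ord_recr /=.
rewrite subnn mulrDr mulrCA taylor_inv_rec0 // addrAC; congr (_ + _).
rewrite mulr_sumr -big_split /=; apply: eq_bigr => i _.
by rewrite subSn ?leq_ord // -(taylor_inv_rec r) //; ring.
Qed.

(** Multiplication by s + b lowers [r] and multiplication by s + a lowers [p]; in the difference the
    contributions of s cancel. This is the recurrence that [partial_fractions] asks for. *)
Lemma taylor_conv_sub a b p r n : a != 0 -> b != 0 ->
  (b - a) * taylor_conv a b p.+1 r.+1 n
  = taylor_conv a b p.+1 r n - taylor_conv a b p r.+1 n.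
Proof.
move=> a0 b0; rewrite mulrBl [in RHS](taylor_convC _ _ p).
case: n => [|n].
  rewrite -(taylor_conv_rec0 a p.+1 r b0) -(taylor_conv_rec0 b r.+1 p a0).
  by rewrite (taylor_convC b).
rewrite -(taylor_conv_rec a p.+1 r n b0) -(taylor_conv_rec b r.+1 p n a0).
by rewrite !(taylor_convC b); ring.
Qed.

Lemma taylor_conv0 a b p n : taylor_conv a b p 0 n = taylor_inv a p n.
Proof.
rewrite /taylor_conv big_ord_recr /= subnn taylor_inv0 mulr1 big1 ?add0r // => i _.
by rewrite taylor_inv0 subn_eq0 leqNgt ltn_ord mulr0.
Qed.

(** Both sides satisfy the recurrence given by multiplication by s + a, which determines them as a
    is invertible; this replaces a binomial convolution identity. *)
Lemma taylor_conv_diag a p r n : a != 0 ->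
  taylor_conv a a p r n = taylor_inv a (p + r) n.
Proof.
move=> a0; elim: r n => [|r IHr] n; first by rewrite taylor_conv0 addn0.
elim: n => [|n IHn]; apply: (mulfI a0).
  by rewrite taylor_conv_rec0 // IHr addnS taylor_inv_rec0.
apply: (addIr (taylor_conv a a p r.+1 n)).
by rewrite taylor_conv_rec // IHr {1}IHn addnS taylor_inv_rec.
Qed.

(** The left side is the value at s = 0 of the principal part at -a of (s + a)^-p s^-q. The
    principal part at 0 has no constant term, so this value is the constant Laurent coefficient at
    0, that is, the coefficient of s^q in (s + a)^-p. The computation is the hockey-stick
    identity. *)
Lemma sum_taylor_inv a p q : a != 0 -> (0 < q)%N ->
  \sum_(j < p) taylor_inv (- a) q j * (a ^+ (p - j))^-1 = taylor_inv a p q.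
Proof.
move=> a0 q0.
have -> : \sum_(j < p) taylor_inv (- a) q j * (a ^+ (p - j))^-1
    = (-1) ^+ q / a ^+ (p + q) * (\sum_(j < p) 'C(q + j - 1, j))%:R.
  rewrite natr_sum mulr_sumr; apply: eq_bigr => j _; rewrite /taylor_inv.
  have -> : (p + q = q + j + (p - j))%N by have := ltn_ord j; lia.
  rewrite [(- a) ^+ _]exprNn [a ^+ (q + j + (p - j))]exprD !invfM.
  rewrite (_ : ((-1) ^+ (q + j))^-1 = (-1) ^+ (q + j) :> F); last first.
    by rewrite -exprVn invrN1.
  have e : (-1) ^+ j * (-1) ^+ j = 1 :> F by rewrite -exprMn mulrNN mulr1 expr1n.
  rewrite [(-1) ^+ (q + j)]exprD.
  transitivity (((-1) ^+ j * (-1) ^+ j) * ((-1) ^+ q * 'C(q + j - 1, j)%:R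
    / a ^+ (q + j) / a ^+ (p - j))); first by ring.
  by rewrite e; ring.
have -> : (\sum_(j < p) 'C(q + j - 1, j) = 'C(p + q - 1, q))%N.
  elim: p => [|p IH]; first by rewrite big_ord0 bin_small //; lia.
  rewrite big_ord_recr /= IH; case: q q0 {IH} => // q _.
  have -> : (p.+1 + q.+1 - 1 = (p + q).+1)%N by lia.
  have -> : (p + q.+1 - 1 = p + q)%N by lia.
  have -> : (q.+1 + p - 1 = p + q)%N by lia.
  by rewrite binS -(bin_sub (leq_addr q p)) addKn.
by rewrite /taylor_inv; ring.
Qed.

End PartialFractions.

(** * The identity between finite sums, for fixed N and M *)

Section FiniteIdentity.
Variable F : numFieldType.
Implicit Types (a b s x z : F) (g h : F -> F) (p q r k l m n M N : nat).

Definition bisum x N g : F :=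
  \sum_(1 <= n < N.+1) (x ^- n * g n%:R + x ^+ n * g (- n%:R)).

Lemma eq_bisum x N g h :
  (forall n, (0 < n)%N -> g n%:R = h n%:R /\ g (- n%:R) = h (- n%:R)) ->
  bisum x N g = bisum x N h.
Proof.
move=> gh; apply: eq_big_nat => n /andP[n0 _].
by have [-> ->] := gh n n0.
Qed.

Lemma bisumD x N g h : bisum x N (fun s => g s + h s) = bisum x N g + bisum x N h.
Proof. by rewrite /bisum -big_split; apply: eq_bigr => n _ /=; ring. Qed.

Lemma bisumZ x N c g : bisum x N (fun s => c * g s) = c * bisum x N g.
Proof. by rewrite /bisum mulr_sumr; apply: eq_bigr => n _ /=; ring. Qed.

Lemma bisum_sum x N (I : Type) (r : seq I) (P : pred I) (G : I -> F -> F) :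
  bisum x N (fun s => \sum_(i <- r | P i) G i s)
  = \sum_(i <- r | P i) bisum x N (G i).
Proof.
rewrite /bisum exchange_big /=; apply: eq_bigr => n _.
by rewrite big_split !mulr_sumr.
Qed.

Definition nonint a := forall n, n%:R + a != 0 /\ - n%:R + a != 0.

Lemma nonint_neq0 a : nonint a -> a != 0.
Proof. by move=> /(_ 0%N)[]; rewrite add0r. Qed.

Definition zsum x N r : F := bisum x N (fun s => (s ^+ r)^-1).

(* The sum over all |n| <= N, including n = 0. *)
Definition shifted_sum x N r a : F :=
  (a ^+ r)^-1 + bisum x N (fun s => ((s + a) ^+ r)^-1).

(** [bisum] leaves out n = 0 because of the pole there, while [shifted_sum] includes it so that
    shifting [a] by 1 is a mere reindexing; [- taylor_inv a p q] takes the surplus terms off again,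
    by [sum_taylor_inv]. *)
Lemma bisum_pole2 x N a p q : nonint a -> (0 < q)%N ->
  bisum x N (fun s => ((s + a) ^+ p)^-1 * (s ^+ q)^-1)
  = \sum_(j < p) taylor_inv (- a) q j * shifted_sum x N (p - j) a
    - taylor_inv a p q + \sum_(j < q) taylor_inv a p j * zsum x N (q - j).
Proof.
move=> ha q0; have a0 := nonint_neq0 ha.
have pf s : s != 0 -> s + a != 0 -> ((s + a) ^+ p)^-1 * (s ^+ q)^-1
    = \sum_(j < p) taylor_inv (- a) q j * ((s + a) ^+ (p - j))^-1
      + \sum_(j < q) taylor_inv a p j * (s ^+ (q - j))^-1.
  move=> s0 sa0.
  have := @partial_fractions F (- a) (fun i j => ((s + a) ^+ i)^-1 * (s ^+ j)^-1).
  rewrite oppr_eq0 opprK => -> //; last by lia.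
  - congr (_ + _); apply: eq_bigr => j _; first by rewrite expr0 invr1 mulr1.
    by rewrite expr0 invr1 mul1r.
  - move=> i j; rewrite !exprS; field.
    by rewrite !expf_neq0 ?s0.
rewrite (@eq_bisum _ _ _ (fun s =>
    \sum_(j < p) taylor_inv (- a) q j * ((s + a) ^+ (p - j))^-1
    + \sum_(j < q) taylor_inv a p j * (s ^+ (q - j))^-1)); last first.
  move=> n hn; have [? ?] := ha n.
  by split; rewrite pf ?oppr_eq0 ?pnatr_eq0 -?lt0n.
rewrite bisumD !bisum_sum; congr (_ + _).
  rewrite -(sum_taylor_inv p a0 q0) -sumrB; apply: eq_bigr => j _.
  by rewrite bisumZ /shifted_sum; ring.
by apply: eq_bigr => j _; rewrite bisumZ.
Qed.

(** The poles -a and -b are separated first, and each is then separated from the pole 0 by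
    [bisum_pole2]. *)
Lemma bisum_pole3 x N a b p r q : nonint a -> nonint b -> a != b ->
  (0 < p + r)%N -> (0 < q)%N ->
  bisum x N (fun s => ((s + a) ^+ p)^-1 * ((s + b) ^+ r)^-1 * (s ^+ q)^-1)
  = \sum_(i < p) taylor_inv (b - a) r i
      * \sum_(j < p - i) taylor_inv (- a) q j * shifted_sum x N (p - i - j) a
    + \sum_(i < r) taylor_inv (a - b) p i
      * \sum_(j < r - i) taylor_inv (- b) q j * shifted_sum x N (r - i - j) b
    - taylor_conv a b p r q
    + \sum_(j < q) taylor_conv a b p r j * zsum x N (q - j).
Proof.
move=> ha hb ab pr q0; have a0 := nonint_neq0 ha; have b0 := nonint_neq0 hb.
have w0 : b - a != 0 by rewrite subr_eq0 eq_sym.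
have pf s : s + a != 0 -> s + b != 0 ->
    ((s + a) ^+ p)^-1 * ((s + b) ^+ r)^-1 * (s ^+ q)^-1
    = \sum_(i < p) taylor_inv (b - a) r i * (((s + a) ^+ (p - i))^-1 * (s ^+ q)^-1)
      + \sum_(i < r) taylor_inv (a - b) p i * (((s + b) ^+ (r - i))^-1 * (s ^+ q)^-1).
  move=> sa0 sb0.
  have := @partial_fractions F (b - a) (fun i j => ((s + a) ^+ i)^-1 * ((s + b) ^+ j)^-1).
  rewrite opprB => -> //; first last.
    by move=> i j; rewrite !exprS; field; rewrite !expf_neq0 ?sa0 ?sb0.
  rewrite mulrDl !mulr_suml; congr (_ + _); apply: eq_bigr => j _.
    by rewrite expr0 invr1 mulr1 mulrA.
  by rewrite expr0 invr1 mul1r mulrA.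
(* The decomposition in a and b read on the coefficient of s^n; it reassembles what the two calls of
   [bisum_pole2] leave at the pole 0. *)
have pfE n : taylor_conv a b p r n =
    \sum_(i < p) taylor_inv (b - a) r i * taylor_inv a (p - i) n
    + \sum_(i < r) taylor_inv (a - b) p i * taylor_inv b (r - i) n.
  rewrite (partial_fractions (G := fun i j => taylor_conv a b i j n) w0) //; last first.
    by move=> i j; apply: taylor_conv_sub.
  rewrite opprB; congr (_ + _); apply: eq_bigr => j _; first by rewrite taylor_conv0.
  by rewrite taylor_convC taylor_conv0.
rewrite (@eq_bisum _ _ _ (fun s =>
    \sum_(i < p) taylor_inv (b - a) r i * (((s + a) ^+ (p - i))^-1 * (s ^+ q)^-1)
    + \sum_(i < r) taylor_inv (a - b) p i
      * (((s + b) ^+ (r - i))^-1 * (s ^+ q)^-1))); last first.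
  by move=> n _; have [? ?] := ha n; have [? ?] := hb n; split; rewrite pf.
rewrite bisumD !bisum_sum.
under eq_bigr do rewrite bisumZ bisum_pole2 // mulrDr mulrBr.
under [X in _ + X]eq_bigr do rewrite bisumZ bisum_pole2 // mulrDr mulrBr.
have -> : \sum_(j < q) taylor_conv a b p r j * zsum x N (q - j)
  = \sum_(i < p) taylor_inv (b - a) r i
      * (\sum_(j < q) taylor_inv a (p - i) j * zsum x N (q - j))
    + \sum_(i < r) taylor_inv (a - b) p i
      * (\sum_(j < q) taylor_inv b (r - i) j * zsum x N (q - j)).
  under eq_bigr do rewrite pfE mulrDl !mulr_suml.
  rewrite big_split /=; congr (_ + _); rewrite exchange_big /=;
    by apply: eq_bigr => i _; rewrite mulr_sumr; apply: eq_bigr => j _; rewrite mulrA.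
by rewrite pfE !big_split /= !sumrN; ring.
Qed.

Definition half_int k : F := k%:R - 2^-1.

Lemma half_int_nonint k : nonint (half_int k).
Proof.
have half_neq m n : m%:R - n%:R != 2^-1 :> F.
  apply/eqP => e.
  have : 2 * (m%:R - n%:R) = 1 :> F by rewrite e mulfV // pnatr_eq0.
  rewrite mulrBr -!natrM => /eqP; rewrite subr_eq addrC natr1 eqr_nat => /eqP; lia.
move=> n; rewrite /half_int; split; rewrite addrA subr_eq0.
  by rewrite -natrD -[X in X != _]subr0 (half_neq _ 0%N).
by rewrite addrC half_neq.
Qed.

Lemma half_int_inj : injective half_int.
Proof. by move=> k l /addIr /eqP; rewrite eqr_nat => /eqP. Qed.

Lemma half_intB l k : half_int l - half_int k = l%:R - k%:R.
Proof. by rewrite /half_int; ring. Qed.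

Definition Psi M p z s : F := \sum_(1 <= k < M.+1) z ^+ k / (s + half_int k) ^+ p.

(* [T r k] stands for the sum of x^-n / (n + k - 1/2)^r over n, or its limit. *)
Definition pole_sum (T : nat -> nat -> F) M p1 x1 p2 x2 q : F :=
  \sum_(1 <= k < M.+1) \sum_(1 <= l < M.+1 | l != k) x1 ^+ k * x2 ^+ l
    * \sum_(i < p1) taylor_inv (half_int l - half_int k) p2 i
    * \sum_(j < p1 - i) taylor_inv (- half_int k) q j * T (p1 - i - j)%N k.

Definition diag_sum (T : nat -> nat -> F) M p z q : F :=
  \sum_(1 <= k < M.+1) z ^+ k
    * \sum_(j < p) taylor_inv (- half_int k) q j * T (p - j)%N k.

(** The coefficient of s^n in the Taylor expansion at 0 of [Psi M p1 x1 s * Psi M p2 x2 s]. *)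
Definition conv_sum M p1 x1 p2 x2 n : F :=
  \sum_(1 <= k < M.+1) \sum_(1 <= l < M.+1)
    x1 ^+ k * x2 ^+ l * taylor_conv (half_int k) (half_int l) p1 p2 n.

Lemma finite_identity x N M p1 x1 p2 x2 q : (0 < p1 + p2)%N -> (0 < q)%N ->
  let T r k := shifted_sum x N r (half_int k) in
  bisum x N (fun s => Psi M p1 x1 s * Psi M p2 x2 s * (s ^+ q)^-1)
  = pole_sum T M p1 x1 p2 x2 q + pole_sum T M p2 x2 p1 x1 q
    + diag_sum T M (p1 + p2) (x1 * x2) q
    - conv_sum M p1 x1 p2 x2 q
    + \sum_(j < q) conv_sum M p1 x1 p2 x2 j * zsum x N (q - j).
Proof.
move=> p0 q0 T.
have -> : bisum x N (fun s => Psi M p1 x1 s * Psi M p2 x2 s * (s ^+ q)^-1)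
  = \sum_(1 <= k < M.+1) \sum_(1 <= l < M.+1) x1 ^+ k * x2 ^+ l
    * bisum x N (fun s => ((s + half_int k) ^+ p1)^-1
                          * ((s + half_int l) ^+ p2)^-1 * (s ^+ q)^-1).
  under [RHS]eq_bigr do under eq_bigr do rewrite -bisumZ.
  under [RHS]eq_bigr do rewrite -bisum_sum.
  rewrite -bisum_sum; apply: eq_bisum.
  have eqs s : Psi M p1 x1 s * Psi M p2 x2 s * (s ^+ q)^-1
    = \sum_(1 <= k < M.+1) \sum_(1 <= l < M.+1) x1 ^+ k * x2 ^+ l
    * (((s + half_int k) ^+ p1)^-1 * ((s + half_int l) ^+ p2)^-1 * (s ^+ q)^-1).
    rewrite /Psi !mulr_suml; apply: eq_bigr => k _.
    by rewrite mulr_sumr mulr_suml; apply: eq_bigr => l _; ring.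
  by move=> n _; rewrite !eqs.
(* For k = l the two poles merge into one of order [p1 + p2]. Writing its coefficients at 0 as
   [taylor_conv] lets [conv_sum] run over all pairs (k, l). *)
have diagE k : bisum x N (fun s => ((s + half_int k) ^+ p1)^-1
      * ((s + half_int k) ^+ p2)^-1 * (s ^+ q)^-1)
    = \sum_(j < p1 + p2) taylor_inv (- half_int k) q j * T (p1 + p2 - j)%N k
      - taylor_conv (half_int k) (half_int k) p1 p2 q
      + \sum_(j < q) taylor_conv (half_int k) (half_int k) p1 p2 j * zsum x N (q - j).
  have hk := half_int_nonint k; have k0 := nonint_neq0 hk.
  rewrite taylor_conv_diag //.
  under [X in _ = _ + X]eq_bigr do rewrite taylor_conv_diag //.
  rewrite -bisum_pole2 //; apply: eq_bisum => n _.
  by rewrite !exprD !invfM.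
have -> : \sum_(j < q) conv_sum M p1 x1 p2 x2 j * zsum x N (q - j)
  = \sum_(1 <= k < M.+1) \sum_(1 <= l < M.+1) x1 ^+ k * x2 ^+ l
    * \sum_(j < q) taylor_conv (half_int k) (half_int l) p1 p2 j * zsum x N (q - j).
  under eq_bigr do rewrite /conv_sum mulr_suml.
  rewrite exchange_big /=; apply: eq_bigr => k _.
  under eq_bigr do rewrite mulr_suml.
  rewrite exchange_big /=; apply: eq_bigr => l _.
  by rewrite mulr_sumr; apply: eq_bigr => j _; rewrite mulrA.
have -> : pole_sum T M p2 x2 p1 x1 q =
  \sum_(1 <= k < M.+1) \sum_(1 <= l < M.+1 | l != k) x1 ^+ k * x2 ^+ l
    * \sum_(i < p2) taylor_inv (half_int k - half_int l) p1 i
    * \sum_(j < p2 - i) taylor_inv (- half_int l) q j * T (p2 - i - j)%N l.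
  rewrite /pole_sum (exchange_big_dep xpredT) //=; apply: eq_bigr => k _.
  by apply: eq_big => [l|l _]; rewrite 1?eq_sym // [x2 ^+ _ * _]mulrC.
rewrite /pole_sum /diag_sum /conv_sum -!(big_split, sumrN) /=.
rewrite big_seq [RHS]big_seq; apply: eq_bigr => k hk.
rewrite (bigD1_seq k) ?iota_uniq //= [X in _ - X + _](bigD1_seq k) ?iota_uniq //=.
rewrite [X in _ = _ + X](bigD1_seq k) ?iota_uniq //=.
transitivity (x1 ^+ k * x2 ^+ k * bisum x N (fun s => ((s + half_int k) ^+ p1)^-1
   * ((s + half_int k) ^+ p2)^-1 * (s ^+ q)^-1) +
  (\sum_(1 <= l < M.+1 | l != k) (x1 ^+ k * x2 ^+ l
    * (\sum_(i < p1) taylor_inv (half_int l - half_int k) p2 i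
    * \sum_(j < p1 - i) taylor_inv (- half_int k) q j * T (p1 - i - j)%N k)
    + x1 ^+ k * x2 ^+ l
    * (\sum_(i < p2) taylor_inv (half_int k - half_int l) p1 i
    * \sum_(j < p2 - i) taylor_inv (- half_int l) q j * T (p2 - i - j)%N l)
    - x1 ^+ k * x2 ^+ l * taylor_conv (half_int k) (half_int l) p1 p2 q
    + x1 ^+ k * x2 ^+ l
    * (\sum_(j < q) taylor_conv (half_int k) (half_int l) p1 p2 j * zsum x N (q - j))))).
  congr (_ + _); apply: eq_bigr => l lk.
  rewrite bisum_pole3 //; try exact: half_int_nonint; last first.
    by apply: contra lk => /eqP /half_int_inj ->.
  by rewrite /T; ring.
rewrite diagE !big_split /= sumrN exprMn; ring.
Qed.

End FiniteIdentity.

(** * Convergence in R[i], with and without a rate *)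

Section Limits.
Variable R : realType.
Local Notation C := R[i].
Implicit Types (x y z l : C) (u v w : nat -> C) (e K : R) (k m n M N p q : nat).

(* The real-valued modulus: inequalities between moduli then live in an
   ordered field, which R[i] is not. *)
Definition modulus z : R := complex.Re `|z|.

Lemma modulusE z : (modulus z)%:C = `|z|.
Proof. by rewrite /modulus RRe_real // normr_real. Qed.

Lemma modulus_ge0 z : 0 <= modulus z.
Proof. by rewrite -lecR modulusE normr_ge0. Qed.

Lemma modulus_eq0 z : (modulus z == 0) = (z == 0).
Proof. by rewrite -(inj_eq (@complexI R)) modulusE normr_eq0. Qed.

Lemma modulus0 : modulus 0 = 0.
Proof. by apply/eqP; rewrite modulus_eq0. Qed.

Lemma modulusN z : modulus (- z) = modulus z.
Proof. by rewrite /modulus normrN. Qed.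

Lemma modulusM x y : modulus (x * y) = modulus x * modulus y.
Proof. by apply: complexI; rewrite rmorphM /= !modulusE normrM. Qed.

Lemma modulusV z : modulus z^-1 = (modulus z)^-1.
Proof. by apply: complexI; rewrite fmorphV /= !modulusE normfV. Qed.

Lemma modulusX z n : modulus (z ^+ n) = modulus z ^+ n.
Proof. by apply: complexI; rewrite rmorphXn /= !modulusE normrX. Qed.

Lemma modulusD x y : modulus (x + y) <= modulus x + modulus y.
Proof. by rewrite -lecR rmorphD /= !modulusE ler_normD. Qed.

Lemma modulusB x y : modulus (x - y) <= modulus x + modulus y.
Proof. by rewrite (le_trans (modulusD _ _)) // modulusN. Qed.

Lemma modulus_distC x y : modulus (x - y) = modulus (y - x).
Proof. by rewrite -modulusN opprB. Qed.

Lemma modulus_dist x y z : modulus (x - z) <= modulus (x - y) + modulus (y - z).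
Proof. by rewrite (_ : x - z = x - y + (y - z)) ?modulusD //; ring. Qed.

Lemma modulus_sum (I : Type) (r : seq I) (P : pred I) (f : I -> C) :
  modulus (\sum_(i <- r | P i) f i) <= \sum_(i <- r | P i) modulus (f i).
Proof.
elim/big_ind2: _ => // [|a b c d ab cd]; first by rewrite modulus0.
by rewrite (le_trans (modulusD _ _)) // lerD.
Qed.

Lemma modulus_real (a : R) : modulus a%:C = `|a|.
Proof. by apply: complexI; rewrite modulusE normc_def /= expr0n addr0 sqrtr_sqr. Qed.

Lemma modulus_nat n : modulus n%:R = n%:R.
Proof. by rewrite -(rmorph_nat (real_complex R)) modulus_real ger0_norm. Qed.

Lemma modulus1 : modulus 1 = 1.
Proof. exact: (modulus_nat 1). Qed.

Lemma modulus_sign n : modulus ((-1) ^+ n) = 1.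
Proof. by rewrite modulusX modulusN modulus1 expr1n. Qed.

Lemma modulus_unity z : is_root_of_unity z -> modulus z = 1.
Proof.
case=> n n0 /unity_rootP zn; apply/eqP.
by rewrite -(@pexpr_eq1 _ _ n) ?modulus_ge0 // -modulusX zn modulus1.
Qed.

Definition tends u l :=
  forall e, 0 < e -> exists N, forall n, (N <= n)%N -> modulus (u n - l) <= e.

(** The bridge to [limn], hence to [csum]. A positive [e] of R[i] is real, so its real part can
    serve as the real tolerance. *)
Lemma tends_lim u l : tends u l -> limn (u : nat -> (C : numFieldType)) = l.
Proof.
move=> ul; apply: cvg_lim; first exact: norm_hausdorff.
apply/cvgrPdist_le => /= e e0.
have er : (complex.Re e)%:C = e by rewrite RRe_real // gtr0_real.
have [N HN] := ul (complex.Re e) ltac:(by rewrite -ltcR er).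
exists N => // n /= Nn; rewrite -er -modulusE lecR modulus_distC; exact: HN.
Qed.

Lemma tends_eq u v l N0 :
  (forall n, (N0 <= n)%N -> u n = v n) -> tends u l -> tends v l.
Proof.
move=> uv ul e e0; have [N HN] := ul e e0; exists (maxn N N0) => n.
by rewrite geq_max => /andP[h1 h2]; rewrite -uv ?HN.
Qed.

Lemma tends_ext u v l : u =1 v -> tends u l -> tends v l.
Proof. by move=> uv; apply: (@tends_eq _ _ _ 0%N) => n _. Qed.

Lemma tends_unique u l l' : tends u l -> tends u l' -> l = l'.
Proof.
move=> ul ul'; apply/eqP; rewrite -subr_eq0 -modulus_eq0.
apply/negPn/negP => d0.
have d : 0 < modulus (l - l') by rewrite lt_neqAle eq_sym d0 modulus_ge0.
have e0 : 0 < modulus (l - l') / 4 by lra.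
have [N HN] := ul _ e0; have [N' HN'] := ul' _ e0.
have h1 := HN (maxn N N') (leq_maxl _ _); have h2 := HN' (maxn N N') (leq_maxr _ _).
have := modulus_dist l (u (maxn N N')) l'; rewrite (modulus_distC l (u _)); lra.
Qed.

Lemma tends_cst l : tends (fun=> l) l.
Proof. by move=> e e0; exists 0%N => n _; rewrite subrr modulus0 ltW. Qed.

Lemma tendsD u v l l' : tends u l -> tends v l' -> tends (fun n => u n + v n) (l + l').
Proof.
move=> ul vl e e0; have e2 : 0 < e / 2 by lra.
have [N HN] := ul _ e2; have [N' HN'] := vl _ e2.
exists (maxn N N') => n; rewrite geq_max => /andP[/HN h1 /HN' h2].
rewrite (_ : _ - _ = (u n - l) + (v n - l')); last by ring.
by rewrite (le_trans (modulusD _ _)) //; lra.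
Qed.

Lemma tendsZ c u l : tends u l -> tends (fun n => c * u n) (c * l).
Proof.
move=> ul e e0; have c1 : 0 < modulus c + 1 by have := modulus_ge0 c; lra.
have [N HN] := ul (e / (modulus c + 1)) ltac:(by rewrite divr_gt0).
exists N => n /HN h; rewrite -mulrBr modulusM.
apply: le_trans (_ : (modulus c + 1) * (e / (modulus c + 1)) <= _).
  by rewrite ler_pM ?modulus_ge0 //; lra.
by rewrite mulrC divfK // gt_eqF.
Qed.

Lemma tendsN u l : tends u l -> tends (fun n => - u n) (- l).
Proof.
move=> /(tendsZ (-1)); rewrite mulN1r; apply: tends_ext => n; exact: mulN1r.
Qed.

Lemma tendsB u v l l' : tends u l -> tends v l' -> tends (fun n => u n - v n) (l - l').
Proof. by move=> ul /tendsN; apply: tendsD. Qed.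

Lemma tends_sum (I : Type) (r : seq I) (P : pred I) (f : I -> nat -> C) (g : I -> C) :
  (forall i, P i -> tends (f i) (g i)) ->
  tends (fun n => \sum_(i <- r | P i) f i n) (\sum_(i <- r | P i) g i).
Proof.
move=> fg; elim: r => [|i r IH].
  by rewrite big_nil; apply: tends_ext (tends_cst 0) => n; rewrite big_nil.
rewrite big_cons; case: ifP => Pi.
  by apply: tends_ext (tendsD (fg _ Pi) IH) => n; rewrite big_cons Pi.
by apply: tends_ext IH => n; rewrite big_cons Pi.
Qed.

Lemma tends_dist0 u v l : tends u l -> tends (fun n => v n - u n) 0 -> tends v l.
Proof.
move=> ul /tendsD /(_ ul); rewrite add0r; apply: tends_ext => n.
by rewrite subrK.
Qed.

Lemma tends_bounded u l : tends u l -> exists2 K, 0 <= K &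
  exists N, forall n, (N <= n)%N -> modulus (u n) <= K.
Proof.
move=> /(_ 1 ltr01)[N HN]; exists (modulus l + 1); first by have := modulus_ge0 l; lra.
exists N => n /HN h; have := modulus_dist (u n) l 0; rewrite !subr0; lra.
Qed.

Lemma tends0_bounded u v K : tends v 0 -> 0 <= K ->
  (forall n, modulus (u n) <= K * modulus (v n)) -> tends u 0.
Proof.
move=> v0 K0 H e e0; have [N HN] := v0 (e / (K + 1)) ltac:(by rewrite divr_gt0 //; lra).
exists N => n /HN; rewrite !subr0 => h; apply: le_trans (H n) _.
apply: le_trans (_ : (K + 1) * (e / (K + 1)) <= _).
  by rewrite ler_pM ?modulus_ge0 //; lra.
by rewrite mulrC divfK // gt_eqF //; lra.
Qed.

Lemma tendsM u v l l' : tends u l -> tends v l' -> tends (fun n => u n * v n) (l * l').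
Proof.
move=> ul vl; have [K K0 [N HN]] := tends_bounded vl.
have h : tends (fun n => u n * v n - l * v n) 0.
  have : tends (fun n => K%:C * (u n - l)) 0.
    rewrite -[X in tends _ X](mulr0 K%:C) -(subrr l); apply/tendsZ/tendsB => //.
    exact: tends_cst.
  move=> kul e e0; have [N' HN'] := kul e e0.
  exists (maxn N N') => n; rewrite geq_max => /andP[/HN h1 /HN'].
  rewrite !subr0 -mulrBl !modulusM modulus_real ger0_norm //.
  by apply: le_trans; rewrite mulrC ler_wpM2r ?modulus_ge0.
by apply: tends_dist0 h; apply: tendsZ.
Qed.

Lemma tends_shift u l k : tends u l -> tends (fun n => u (n + k)%N) l.
Proof.
move=> ul e e0; have [N HN] := ul e e0; exists N => n Nn; apply: HN.
by rewrite (leq_trans Nn) ?leq_addr.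
Qed.

Lemma tends_invn K : tends (fun n => (K / n.+1%:R)%:C) 0.
Proof.
move=> e e0; exists (Num.truncn (`|K| / e)).+1 => n hn.
rewrite subr0 modulus_real normrM normfV [`|n.+1%:R|]ger0_norm //.
rewrite ler_pdivrMr // -ler_pdivrMl // mulrC.
have := truncnS_gt (`|K| / e).
by move=> /ltW /le_trans; apply; rewrite ler_nat ltnW.
Qed.

(** Convergence with error O(1/n), the property of the tails on which the exchange of limits
    rests. *)
Definition rated u l := exists K, forall n, modulus (u n - l) <= K / n.+1%:R.

Lemma rated_bound u l : rated u l ->
  exists2 K, 0 <= K & forall n, modulus (u n - l) <= K / n.+1%:R.
Proof.
case=> K HK; exists K => //.
by have := le_trans (modulus_ge0 _) (HK 0%N); rewrite divr1.
Qed.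

Lemma rated_tends u l : rated u l -> tends u l.
Proof.
move=> [K HK] e e0; have [N HN] := tends_invn K e0; exists N => n /HN.
by rewrite subr0 modulus_real => h; apply: le_trans (HK n) (le_trans (ler_norm _) h).
Qed.

Lemma rated_bounded u l : rated u l -> exists2 K, 0 <= K & forall n, modulus (u n) <= K.
Proof.
move=> /rated_bound[K K0 HK]; exists (modulus l + K).
  by rewrite addr_ge0 ?modulus_ge0.
move=> n; have := modulus_dist (u n) l 0; rewrite !subr0 => /le_trans; apply.
rewrite addrC lerD2l; apply: le_trans (HK n) _.
by rewrite ler_pdivrMr // ler_peMr // ler1n.
Qed.

Lemma rated_ext u v l : u =1 v -> rated u l -> rated v l.
Proof. by move=> uv [K HK]; exists K => n; rewrite -uv. Qed.

Lemma rated_cst l : rated (fun=> l) l.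
Proof. by exists 0 => n; rewrite subrr modulus0 mul0r. Qed.

Lemma ratedD u v l l' : rated u l -> rated v l' -> rated (fun n => u n + v n) (l + l').
Proof.
move=> [K HK] [K' HK']; exists (K + K') => n.
rewrite (_ : _ - _ = (u n - l) + (v n - l')); last by ring.
by rewrite (le_trans (modulusD _ _)) // mulrDl lerD.
Qed.

Lemma ratedM u v l l' : rated u l -> rated v l' -> rated (fun n => u n * v n) (l * l').
Proof.
move=> ru rv; have [B B0 HB] := rated_bounded rv.
have [K K0 HK] := rated_bound ru; have [K' K'0 HK'] := rated_bound rv.
exists (K * B + modulus l * K') => n.
rewrite (_ : _ - _ = (u n - l) * v n + l * (v n - l')); last by ring.
rewrite (le_trans (modulusD _ _)) // !modulusM mulrDl [K * B]mulrC -!mulrA.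
rewrite [modulus (u n - l) * _]mulrC.
by rewrite lerD // ?ler_wpM2l ?modulus_ge0 // ler_pM ?modulus_ge0.
Qed.

(** Each left endpoint a m - K/(m+1) lies below each right endpoint a n + K/(n+1), so the supremum
    of the left endpoints belongs to all these intervals. *)
Lemma real_cauchy_rated (a : nat -> R) K :
  (forall m n, (m <= n)%N -> `|a n - a m| <= K / m.+1%:R) ->
  exists b : R, forall n, `|a n - b| <= K / n.+1%:R.
Proof.
move=> Ha.
have K0 : 0 <= K by have := Ha 0%N 0%N (leqnn _); rewrite subrr normr0 divr1.
pose S : set R := [set t | exists m, t = a m - K / m.+1%:R]%classic.
have Sub n : ubound S (a n + K / n.+1%:R).
  move=> _ [m ->].
  have i0 k : 0 <= K / k.+1%:R by rewrite divr_ge0.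
  case: (leqP m n) => mn.
    have := Ha m n mn; rewrite ler_distl => /andP[h1 h2].
    by rewrite (le_trans h1) // lerDl i0.
  have := Ha n m (ltnW mn); rewrite ler_distl => /andP[h1 h2].
  by rewrite (le_trans _ h2) // gerDl oppr_le0 i0.
have S0 : (S !=set0)%classic by exists (a 0%N - K / 1); exists 0%N.
exists (sup S) => n; rewrite ler_distlC; apply/andP; split.
  by apply: ub_le_sup; [exists (a n + K / n.+1%:R); exact: Sub | exists n].
exact: sup_le_ub.
Qed.

Lemma cauchy_rated u K :
  (forall m n, (m <= n)%N -> modulus (u n - u m) <= K / m.+1%:R) ->
  exists l, rated u l.
Proof.
move=> Hu.
have Re_le z : `|complex.Re z| <= modulus z by rewrite -lecR modulusE normc_ge_Re.
have Im_le z : `|complex.Im z| <= modulus z.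
  have := Re_le (z * 'i%C); rewrite ReiNIm normrN modulusM.
  suff -> : modulus 'i%C = 1 by rewrite mulr1.
  by rewrite /modulus normc_def /= expr0n expr1n add0r sqrtr1.
have ReB x y : complex.Re (x - y) = complex.Re x - complex.Re y by case: x y => ? ? [].
have ImB x y : complex.Im (x - y) = complex.Im x - complex.Im y by case: x y => ? ? [].
have [|a Ha] := @real_cauchy_rated (fun n => complex.Re (u n)) K.
  by move=> m n mn; rewrite -ReB; apply: le_trans (Re_le _) (Hu _ _ mn).
have [|b Hb] := @real_cauchy_rated (fun n => complex.Im (u n)) K.
  by move=> m n mn; rewrite -ImB; apply: le_trans (Im_le _) (Hu _ _ mn).
exists (a%:C + 'i%C * b%:C); exists (K + K) => n.
rewrite [u n]complexE.
rewrite (_ : _ - _ = (complex.Re (u n) - a)%:C + 'i%C * (complex.Im (u n) - b)%:C).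
  rewrite (le_trans (modulusD _ _)) // modulusM !modulus_real mulrDl.
  suff -> : modulus 'i%C = 1 by rewrite mul1r lerD.
  by rewrite /modulus normc_def /= expr0n expr1n add0r sqrtr1.
by rewrite !rmorphB /=; ring.
Qed.

End Limits.

(** * Convergence rates of Li, ti, S~ and R *)

Section Series.
Variable R : realType.
Local Notation C := R[i].
Implicit Types (x y z l : C) (u v w f g : nat -> C) (h K : R).
Implicit Types (k m n M N p q : nat) (pzs : seq (nat * C)).

(** The condition under which [Li p z] and [ti p z] are genuine limits and not default values. *)
Definition admissible p z := [/\ (0 < p)%N, is_root_of_unity z & (p, z) <> (1%N, 1)].

Lemma big_natB f m n : (m <= n)%N ->
  \sum_(1 <= k < n.+1) f k - \sum_(1 <= k < m.+1) f k = \sum_(m.+1 <= k < n.+1) f k.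
Proof.
move=> mn; apply/eqP; rewrite subr_eq addrC; apply/eqP.
by rewrite (@big_cat_nat _ _ _ m.+1).
Qed.

(** The majorant telescopes, K/(k(k+1)) = K/k - K/(k+1), so the tail beyond m is at most K/(m+1). *)
Lemma rated_of_summable f K :
  (forall k, (0 < k)%N -> modulus (f k) <= K / (k%:R * k.+1%:R)) ->
  exists l, rated (fun n => \sum_(1 <= k < n.+1) f k) l.
Proof.
move=> Hf; have K0 : 0 <= K.
  have := le_trans (modulus_ge0 _) (Hf 1%N isT).
  by rewrite pmulr_lge0 // invr_gt0 mulr_gt0.
apply: (@cauchy_rated _ _ K) => m n mn.
rewrite big_natB //.
apply: le_trans (modulus_sum _ _ _) _.
apply: le_trans (_ : \sum_(m.+1 <= k < n.+1) (K / k%:R - K / k.+1%:R) <= _).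
  rewrite big_nat_cond [leRHS]big_nat_cond; apply: ler_sum => k.
  rewrite andbT => /andP[mk _]; have k0 : (0 < k)%N by lia.
  apply: le_trans (Hf k k0) _; rewrite le_eqVlt; apply/orP; left; apply/eqP.
  by rewrite -[k.+1%:R]natr1; field; rewrite natr1 !pnatr_eq0; lia.
under eq_bigr do rewrite -opprB.
rewrite sumrN telescope_sumr // opprB gerDl oppr_le0 divr_ge0 //.
Qed.

Section PowerSums.
Variable h : R.
Hypothesis h_bounds : 0 <= h <= 2^-1.

(** Treats [zetan] (h = 0) and [tn] (h = 1/2) at once. *)
Definition psum p z n : C := \sum_(1 <= k < n.+1) z ^+ k / (k%:R - h%:C) ^+ p.

Lemma modulus_shift k : (0 < k)%N -> modulus (k%:R - h%:C) = k%:R - h.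
Proof.
move=> k0; rewrite -(rmorph_nat (real_complex R)) -rmorphB modulus_real ger0_norm //.
have : 1 <= k%:R :> R by rewrite ler1n.
by case/andP: h_bounds; lra.
Qed.

(** For k >= 1 and h <= 1/2 one has k - h >= k/2, whence the factor 2^p. *)
Lemma inv_shift_le p k : (0 < k)%N ->
  modulus ((k%:R - h%:C) ^+ p)^-1 <= 2 ^+ p / k%:R ^+ p.
Proof.
move=> k0; have k1 : 1 <= k%:R :> R by rewrite ler1n.
have [h0 h2] := andP h_bounds.
rewrite modulusV modulusX modulus_shift // -expr_div_n -exprVn.
apply: lerXn2r; rewrite ?nnegrE ?invr_ge0; try lra.
  by rewrite divr_ge0.
rewrite -[_ / _]invrK invf_div lef_pV2 ?posrE; try lra.
Qed.

Lemma inv_shift_le1 p k : (0 < p)%N -> (0 < k)%N ->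
  modulus ((k%:R - h%:C) ^+ p)^-1 <= 2 ^+ p / k%:R.
Proof.
move=> p0 k0; apply: le_trans (inv_shift_le p k0) _.
rewrite ler_wpM2l ?exprn_ge0 // lef_pV2 ?posrE ?exprn_gt0 ?ltr0n //.
by rewrite -[leLHS]expr1 ler_weXn2l // ler1n.
Qed.

Lemma inv_shift_le2 p k : (1 < p)%N -> (0 < k)%N ->
  modulus ((k%:R - h%:C) ^+ p)^-1 <= 2 * 2 ^+ p / (k%:R * k.+1%:R).
Proof.
move=> p1 k0; apply: le_trans (inv_shift_le p k0) _.
have k1 : 1 <= k%:R :> R by rewrite ler1n.
have k2 : 0 < k%:R * k.+1%:R :> R by rewrite mulr_gt0 ?ltr0n.
rewrite [2 * _]mulrC -mulrA ler_wpM2l ?exprn_ge0 //.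
rewrite -[leRHS]invrK invf_div lef_pV2 ?posrE ?exprn_gt0 ?ltr0n ?divr_gt0 //.
rewrite ler_pdivrMr // -natr1.
have : k%:R ^+ 2 <= k%:R ^+ p :> R by rewrite ler_weXn2l.
by nra.
Qed.

(* Abel summation: the partial sums of z^k are bounded by 2 / |1 - z|. *)
Lemma abel_tail z m n : modulus z = 1 -> (m <= n)%N ->
  modulus ((1 - z) * \sum_(m.+1 <= k < n.+1) z ^+ k / (k%:R - h%:C)) <= 2 / (m.+1%:R - h).
Proof.
move=> z1 mn; have [h0 h2] := andP h_bounds.
have pos k : 0 < k.+1%:R - h :> R.
  by have : 1 <= k.+1%:R :> R by [rewrite ler1n]; lra.
have [->|mn'] := eqVneq m n.
  by rewrite big_geq // mulr0 modulus0 divr_ge0 // ltW.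
have {mn mn'} mn : (m.+1 <= n)%N by rewrite ltn_neqAle mn'.
pose S n := \sum_(m.+1 <= k < n.+1) z ^+ k / (k%:R - h%:C).
have mod k : (0 < k)%N -> modulus (k%:R - h%:C)^-1 = (k%:R - h)^-1.
  by move=> k0; rewrite modulusV modulus_shift.
have zk k y : modulus (z ^+ k * y) = modulus y.
  by rewrite modulusM modulusX z1 expr1n mul1r.
(* With the boundary term included, going from n to n + 1 changes the left-hand expression by
   z^(n+1) (1/(n-h) - 1/(n+1-h)), whose modulus is exactly the growth of the bound. *)
have key : modulus ((1 - z) * S n + z ^+ n.+1 / (n%:R - h%:C))
    <= 2 / (m.+1%:R - h) - (n%:R - h)^-1.
  elim: n mn => // n IH; rewrite leq_eqVlt => /orP[/eqP[<-]|mn].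
    rewrite /S big_nat1 [z ^+ m.+2]exprSr.
    rewrite (_ : _ + _ = z ^+ m.+1 / (m.+1%:R - h%:C)); last by ring.
    by rewrite zk mod //; lra.
  have n0 : (0 < n)%N by lia.
  have -> : (1 - z) * S n.+1 + z ^+ n.+2 / (n.+1%:R - h%:C)
      = ((1 - z) * S n + z ^+ n.+1 / (n%:R - h%:C))
        - z ^+ n.+1 * ((n%:R - h%:C)^-1 - (n.+1%:R - h%:C)^-1).
    have -> : S n.+1 = S n + z ^+ n.+1 / (n.+1%:R - h%:C).
      by rewrite /S big_nat_recr // ltnW.
    by rewrite [z ^+ n.+2]exprSr; ring.
  apply: le_trans (modulusB _ _) _; rewrite zk.
  have -> : modulus ((n%:R - h%:C)^-1 - (n.+1%:R - h%:C)^-1)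
      = (n%:R - h)^-1 - (n.+1%:R - h)^-1.
    rewrite -!(rmorph_nat (real_complex R)) -!rmorphB -!fmorphV -rmorphB modulus_real.
    rewrite ger0_norm // subr_ge0 lef_pV2 ?posrE //; last by case: n n0 {IH mn}.
    by rewrite lerD2r ler_nat.
  have := IH mn; lra.
have n0 : (0 < n)%N by lia.
have -> : (1 - z) * S n = ((1 - z) * S n + z ^+ n.+1 / (n%:R - h%:C))
   - z ^+ n.+1 / (n%:R - h%:C) by ring.
by apply: le_trans (modulusB _ _) _; rewrite zk mod //; lra.
Qed.

Lemma psum_rated p z : admissible p z -> exists l, rated (psum p z) l.
Proof.
case=> p0 zr pz; have z1 := modulus_unity zr.
have zk k y : modulus (z ^+ k * y) = modulus y.
  by rewrite modulusM modulusX z1 expr1n mul1r.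
have [p1|p1] := ltnP 1 p.
  apply: (@rated_of_summable _ (2 * 2 ^+ p)) => k k0.
  by rewrite zk inv_shift_le2.
have {p0 p1 pz} [-> nz] : p = 1%N /\ z != 1.
  have e : p = 1%N by lia.
  by split=> //; apply: contra_notN pz => /eqP ->; rewrite e.
have d0 : 0 < modulus (1 - z).
  by rewrite lt_neqAle modulus_ge0 eq_sym modulus_eq0 subr_eq0 eq_sym nz.
apply: (@cauchy_rated _ _ (4 / modulus (1 - z))) => m n mn.
rewrite /psum big_natB //.
under eq_bigr do rewrite expr1.
rewrite mulrAC ler_pdivlMr // mulrC -modulusM.
apply: le_trans (abel_tail z1 mn) _; have [h0 h2] := andP h_bounds.
have : 1 <= m.+1%:R :> R by rewrite ler1n.
move=> m1; rewrite ler_pdivrMr; last by lra.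
rewrite mulrAC ler_pdivlMr; last by lra.
lra.
Qed.

(** Split w k = (w k - l) + l. The first part has terms O(1/k) O(1/k) and is absolutely summable
    even for q = 1; the second is l times a [psum]. *)
Lemma wsum_rated q z w l : rated w l -> admissible q z ->
  exists L, rated (fun n => \sum_(1 <= k < n.+1) w k * (z ^+ k / (k%:R - h%:C) ^+ q)) L.
Proof.
move=> /rated_bound[K K0 HK] qz; have [L HL] := psum_rated qz.
have [q0 /modulus_unity z1 _] := qz.
have [|L' HL'] := @rated_of_summable
    (fun k => (w k - l) * (z ^+ k / (k%:R - h%:C) ^+ q)) (K * 2 ^+ q).
  move=> k k0; rewrite !modulusM modulusX z1 expr1n mul1r.
  rewrite (_ : _ / _ = K / k.+1%:R * (2 ^+ q / k%:R)).
    by rewrite ler_pM ?modulus_ge0 // inv_shift_le1.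
  by rewrite -[k.+1%:R]natr1; field; rewrite natr1 !pnatr_eq0; lia.
exists (L' + l * L); apply: rated_ext (ratedD HL' (ratedM (rated_cst l) HL)) => n.
by rewrite /psum mulr_sumr -big_split; apply: eq_bigr => k _ /=; ring.
Qed.

Lemma prod_psum_rated pzs : (forall pz, pz \in pzs -> admissible pz.1 pz.2) ->
  exists l, rated (fun n => \prod_(pz <- pzs) psum pz.1 pz.2 n) l.
Proof.
elim: pzs => [|pz pzs IH] H.
  by exists 1; apply: rated_ext (rated_cst 1) => n; rewrite big_nil.
have [|l Hl] := IH; first by move=> pz' h'; apply: H; rewrite inE h' orbT.
have [l' Hl'] := psum_rated (H pz (mem_head _ _)).
by exists (l' * l); apply: rated_ext (ratedM Hl' Hl) => n; rewrite big_cons.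
Qed.

End PowerSums.

Lemma zetanE n p z : zetan n p z = psum 0 p z n.
Proof. by apply: eq_bigr => k _; rewrite subr0. Qed.

Lemma tnE n p z : tn n p z = psum 2^-1 p z n.
Proof.
apply: eq_bigr => k _; congr (_ / (_ - _) ^+ _).
by rewrite fmorphV rmorph_nat.
Qed.

Let bounds0 : 0 <= (0 : R) <= 2^-1. Proof. by rewrite lexx invr_ge0 ler0n. Qed.
Let bounds2 : 0 <= (2^-1 : R) <= 2^-1. Proof. by rewrite lexx invr_ge0 ler0n. Qed.

Lemma tends_unshift u l : tends (fun n => u n.+1) l -> tends u l.
Proof.
by move=> ul e e0; have [N HN] := ul e e0; exists N.+1 => -[|n] // /HN.
Qed.

Lemma csum1_tends u l : tends (fun n => \sum_(1 <= k < n.+1) u k) l -> csum 1 u = l.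
Proof. by move=> /(@tends_unshift (fun n => \sum_(1 <= k < n) u k)) /tends_lim. Qed.

Lemma Li_rated p z : admissible p z -> rated (fun n => zetan n p z) (Li p z).
Proof.
move=> /(psum_rated bounds0)[l Hl].
have H : rated (fun n => zetan n p z) l by apply: rated_ext Hl => n; rewrite zetanE.
by rewrite /Li (csum1_tends (rated_tends H)).
Qed.

Lemma ti_rated p z : admissible p z -> rated (fun n => tn n p z) (ti p z).
Proof.
move=> /(psum_rated bounds2)[l Hl].
have H : rated (fun n => tn n p z) l by apply: rated_ext Hl => n; rewrite tnE.
by rewrite /ti (csum1_tends (rated_tends H)).
Qed.

Lemma Stilde_tends pzs q z : (forall pz, pz \in pzs -> admissible pz.1 pz.2) ->
  admissible q z ->
  tends (fun N => \sum_(1 <= n < N.+1)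
    (\prod_(pz <- pzs) tn n pz.1 pz.2) / n%:R ^+ q * z ^+ n) (Stilde pzs q z).
Proof.
move=> /(prod_psum_rated bounds2)[l Hl] qz.
have [L HL] := wsum_rated bounds0 Hl qz.
have H : tends (fun N => \sum_(1 <= n < N.+1)
    (\prod_(pz <- pzs) tn n pz.1 pz.2) / n%:R ^+ q * z ^+ n) L.
  apply: tends_ext (rated_tends HL) => N; apply: eq_bigr => n _.
  rewrite subr0 (eq_bigr (fun pz => tn n pz.1 pz.2)); last by move=> pz _; rewrite tnE.
  by rewrite [in RHS]mulrAC mulrA.
by rewrite /Stilde (csum1_tends H).
Qed.

Lemma Rsum_tends pzs q z : (forall pz, pz \in pzs -> admissible pz.1 pz.2) ->
  admissible q z ->
  tends (fun N => \sum_(1 <= k < N.+1)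
    (\prod_(pz <- pzs) zetan k.-1 pz.1 pz.2) * (z ^+ k / half_int C k ^+ q))
    (z * Rsum pzs q z).
Proof.
move=> /(prod_psum_rated bounds0)[l Hl] qz.
have z0 : z != 0.
  by have [_ /modulus_unity z1 _] := qz; rewrite -modulus_eq0 z1 oner_eq0.
have Hl' : rated (fun n => \prod_(pz <- pzs) zetan n.-1 pz.1 pz.2) l.
  (* The factor 2 pays for the index n - 1: 1/n <= 2/(n+1) for n >= 1. *)
  have [K K0 HK] := rated_bound Hl; exists (2 * K) => n.
  under eq_bigr do rewrite zetanE.
  apply: le_trans (HK n.-1) _; rewrite [2 * K]mulrC -mulrA ler_wpM2l //.
  case: n => [|n] /=; first by rewrite !divr1 invr1 ler1n.
  rewrite ler_pdivlMr // mulrC ler_pdivrMr // -natrM ler_nat; lia.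
have [L HL] := wsum_rated bounds2 Hl' qz.
have H : tends (fun N => \sum_(1 <= k < N.+1)
    (\prod_(pz <- pzs) zetan k.-1 pz.1 pz.2) * (z ^+ k / half_int C k ^+ q)) L.
  apply: tends_ext (rated_tends HL) => N; apply: eq_bigr => k _.
  by rewrite /half_int fmorphV rmorph_nat.
suff -> : Rsum pzs q z = z^-1 * L by rewrite mulVKf.
apply: tends_lim; apply: tends_ext (tendsZ z^-1 H) => N.
rewrite big_add1 /= mulr_sumr; apply: eq_bigr => n _.
rewrite exprS /half_int -natr1.
rewrite (_ : n%:R + 1 - 2^-1 = n%:R + 2^-1); last by field.
by rewrite -!mulrA mulrCA mulKf // [z ^+ n * _]mulrC.
Qed.

Definition harmonic_conv M : R :=
  \sum_(1 <= k < M.+1) k%:R^-1 * (M.+1 - k)%:R^-1.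

(** As 1/(k(M+1-k)) = (1/k + 1/(M+1-k))/(M+1), the sum is 2 H_M/(M+1) with H_M the harmonic number.
    In H_M the first m terms are at most 1 and the others at most 1/(m+1), so H_M <= m + M/(m+1) for
    every m, which gives H_M = o(M). *)
Lemma harmonic_conv_tends : tends (fun M => (harmonic_conv M)%:C) 0.
Proof.
have harm m M : \sum_(1 <= k < M.+1) k%:R^-1 <= m%:R + M%:R / m.+1%:R :> R.
  apply: le_trans (_ : (minn M m)%:R + M%:R / m.+1%:R <= _); last first.
    by rewrite lerD2r ler_nat geq_minr.
  elim: M => [|M IH]; first by rewrite big_geq // mul0r addr0.
  rewrite big_nat_recr //=; have [hM|hM] := leqP M.+1 m.
    rewrite ?(minn_idPl hM); rewrite (minn_idPl (ltnW hM)) in IH.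
    have h1 : M.+1%:R^-1 <= 1 :> R by rewrite invf_le1 ?ltr0n // ler1n.
    have h2 : M%:R / m.+1%:R <= M.+1%:R / m.+1%:R :> R by rewrite ler_pM2r ?invr_gt0 // ler_nat.
    rewrite -[X in _ <= X + _]natr1 addrAC lerD //.
    by apply: le_trans IH _; rewrite lerD2l.
  rewrite ?(minn_idPr (ltnW hM)); rewrite (minn_idPr (hM : (m <= M)%N)) in IH.
  have h1 : M.+1%:R^-1 <= m.+1%:R^-1 :> R by rewrite lef_pV2 ?posrE ?ltr0n // ler_nat.
  by rewrite -[X in _ <= _ + X / _]natr1 mulrDl mul1r addrA lerD.
have hcE M : harmonic_conv M = 2 * (\sum_(1 <= k < M.+1) k%:R^-1) / M.+1%:R.
  rewrite [2 * _]mulrDl mul1r {2}big_nat_rev /= -big_split /= mulr_suml.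
  apply: eq_big_nat => k /andP[k0 kM]; rewrite add1n subSS.
  have e : M.+1%:R = k%:R + (M.+1 - k)%:R :> R by rewrite -natrD; congr (_%:R); lia.
  by rewrite e; field; rewrite -e !pnatr_eq0; lia.
have hc0 M : 0 <= harmonic_conv M.
  by apply: sumr_ge0 => k _; rewrite mulr_ge0 ?invr_ge0.
move=> e e0; have e2 : 0 < e / 2 by lra.
have [m Hm] := tends_invn 2 e2.
have [N HN] := tends_invn (2 * m%:R) e2.
exists N => M /HN; have := Hm m (leqnn _).
rewrite !subr0 !modulus_real !ger0_norm ?divr_ge0 ?mulr_ge0 //.
move=> h1 h2; rewrite hcE ler_pdivrMr //.
have := harm m M; set H := (\sum_(_ <= _ < _) _) => hH.
have h3 : 2 * m%:R <= e / 2 * M.+1%:R by rewrite -ler_pdivrMr.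
have h4 : M%:R * (2 / m.+1%:R) <= M%:R * (e / 2) by rewrite ler_wpM2l.
have h5 : M%:R * (2 / m.+1%:R) = 2 * (M%:R / m.+1%:R) :> R by ring.
apply: le_trans (ler_wpM2l _ hH) _ => //.
rewrite mulrDr -h5 (_ : e * _ = e / 2 * M.+1%:R + e / 2 * M.+1%:R); last by field.
by rewrite lerD // (le_trans h4) // mulrC ler_wpM2l ?ler_nat // ltW.
Qed.

(** Serves to replace an inner sum cut at M - k by its limit; the total error is at most a constant
    times [harmonic_conv M]. *)
Lemma conv_tends0 g w l K : 0 <= K -> rated w l ->
  (forall k, (0 < k)%N -> modulus (g k) <= K / k%:R) ->
  tends (fun M => \sum_(1 <= k < M.+1) g k * (w (M - k)%N - l)) 0.
Proof.
move=> K0 /rated_bound[K' K'0 HK'] Hg.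
apply: (tends0_bounded harmonic_conv_tends (mulr_ge0 K0 K'0)) => M.
apply: le_trans (modulus_sum _ _ _) _; rewrite modulus_real.
apply: le_trans (ler_wpM2l (mulr_ge0 K0 K'0) (ler_norm _)).
rewrite mulr_sumr big_nat_cond [leRHS]big_nat_cond; apply: ler_sum => k.
rewrite andbT => /andP[k0 kM]; rewrite modulusM mulrACA.
by rewrite ler_pM ?modulus_ge0 ?Hg // subSn.
Qed.

End Series.

(** * The kernel sums over n, and Phi at integers *)

Section KernelLimits.
Variable R : realType.
Local Notation C := R[i].
Implicit Types (x z l : C) (u : nat -> C) (k m n M N p q r : nat).

Lemma root_of_unity_neq0 z : is_root_of_unity z -> z != 0.
Proof. by move=> /modulus_unity z1; rewrite -modulus_eq0 z1 oner_eq0. Qed.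

Lemma root_of_unityV z : is_root_of_unity z -> is_root_of_unity z^-1.
Proof.
case=> n n0 /unity_rootP zn; exists n => //.
by apply/unity_rootP; rewrite exprVn zn invr1.
Qed.

Lemma root_of_unityM x z :
  is_root_of_unity x -> is_root_of_unity z -> is_root_of_unity (x * z).
Proof.
case=> n n0 /unity_rootP xn [m m0 /unity_rootP zm].
exists (n * m)%N; first by rewrite muln_gt0 n0.
by apply/unity_rootP; rewrite exprMn exprM xn mulnC exprM zm !expr1n mulr1.
Qed.

Lemma admissibleV p z : admissible p z -> admissible p z^-1.
Proof.
case=> p0 zr pz; split=> //; first exact: root_of_unityV.
by case=> p1 /(congr1 GRing.inv); rewrite invrK invr1 => z1; apply: pz; rewrite p1 z1.
Qed.

Lemma admissible_add p z k : admissible p z -> admissible (p + k) z.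
Proof.
case=> p0 zr pz; split=> //; first by lia.
case=> e z1; apply: pz; rewrite z1; congr (_, _); lia.
Qed.

Lemma invrNX z r : ((- z) ^+ r)^-1 = (-1) ^+ r * (z ^+ r)^-1.
Proof. by rewrite [in LHS]exprNn invfM -exprVn invrN1. Qed.

Lemma tends_unshiftn u l k : tends (fun n => u (n + k)%N) l -> tends u l.
Proof.
move=> ul e e0; have [N HN] := ul e e0; exists (N + k)%N => n Nn.
by have := HN (n - k)%N; rewrite subnK; [apply|]; lia.
Qed.

Lemma half_int_inv_le p k : (0 < p)%N -> (0 < k)%N ->
  modulus ((half_int C k) ^+ p)^-1 <= 2 ^+ p / k%:R.
Proof.
move=> p0 k0; have := @inv_shift_le1 R 2^-1 _ p k p0 k0.
by rewrite fmorphV rmorph_nat; apply; rewrite lexx invr_ge0 ler0n.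
Qed.

Lemma half_int_inv_tends r z (s : nat -> nat) : (0 < r)%N -> modulus z = 1 ->
  tends (fun n => z ^+ s n * (half_int C n.+1 ^+ r)^-1) 0.
Proof.
move=> r0 z1; apply: (tends0_bounded (tends_invn (2 ^+ r)) (@ler01 R)) => n.
rewrite modulusM modulusX z1 expr1n !mul1r modulus_real ger0_norm ?divr_ge0 ?exprn_ge0 //.
exact: half_int_inv_le.
Qed.

Lemma bisumS x N (g : C -> C) : bisum x N.+1 g
  = bisum x N g + (x ^- N.+1 * g N.+1%:R + x ^+ N.+1 * g (- N.+1%:R)).
Proof. by rewrite /bisum big_nat_recr. Qed.

(** Reindexing n to n + 1 moves the window from [-N, N] to [-N+1, N+1]: the term at N + 1 enters and
    the term at -N leaves. *)
Lemma shifted_sumS x N r (a : C) : x != 0 ->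
  shifted_sum x N r (a + 1) = x * (shifted_sum x N r a
    + x ^- N.+1 * ((N.+1%:R + a) ^+ r)^-1 - x ^+ N * ((a - N%:R) ^+ r)^-1).
Proof.
move=> x0; rewrite /shifted_sum.
have st c : c + bisum x N (fun s => ((s + (a + 1)) ^+ r)^-1)
  = c - ((a + 1) ^+ r)^-1 + x * ((a ^+ r)^-1 + bisum x N (fun s => ((s + a) ^+ r)^-1)
    + x ^- N.+1 * ((N.+1%:R + a) ^+ r)^-1 - x ^+ N * ((a - N%:R) ^+ r)^-1).
  elim: N c => [|N IH] c.
    rewrite /bisum !big_geq // expr1 expr0 subr0 addr0 mul1r [1%:R + a]addrC.
    by move: (((a + 1) ^+ r)^-1) ((a ^+ r)^-1) => P Q; field.
  rewrite !bisumS addrCA addrC IH.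
  have -> : N.+1%:R + (a + 1) = N.+2%:R + a by rewrite -[N.+2%:R]natr1; ring.
  have -> : - N.+1%:R + (a + 1) = a - N%:R by rewrite -natr1; ring.
  have -> : - N.+1%:R + a = a - N.+1%:R by ring.
  have e1 : x ^- N.+1 = x * x ^- N.+2 by rewrite [x ^+ N.+2]exprS invfM mulVKf.
  have e2 : x ^+ N.+1 = x * x ^+ N by rewrite exprS.
  rewrite !e1 e2; move: (x ^- N.+2) (x ^+ N) (bisum x N _) => E P B.
  move: (((N.+2%:R + a) ^+ r)^-1) (((a - N.+1%:R) ^+ r)^-1) (((a - N%:R) ^+ r)^-1) => P1 P2 P3.
  move: (((N.+1%:R + a) ^+ r)^-1) ((a ^+ r)^-1) (((a + 1) ^+ r)^-1) => P4 P5 P6.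
  ring.
by rewrite st subrr add0r.
Qed.

Lemma tnS n p z : tn n.+1 p z = tn n p z + z ^+ n.+1 / half_int C n.+1 ^+ p.
Proof. by rewrite /tn big_nat_recr. Qed.

(** Here x * kappa is the symmetric sum of x^-n/(n + 1/2)^r over all integers n. The bracket (-1)^k
    ti_{k+1}(x) - x ti_{k+1}(1/x) of the theorem is -x times [kappa x k.+1]. *)
Definition kappa x r : C := ti r x^-1 + (-1) ^+ r * x^-1 * ti r x.

(** By induction on k: each unit shift multiplies the limit by x, because the two boundary terms of
    [shifted_sumS] vanish. *)
Lemma shifted_sum_tends x r k : is_root_of_unity x -> (0 < r)%N -> (0 < k)%N ->
  tends (fun N => shifted_sum x N r (half_int C k)) (x ^+ k * kappa x r).
Proof.
move=> xr r0; have x1 := modulus_unity xr; have x0 := root_of_unity_neq0 xr.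
have xV1 : modulus x^-1 = 1 by rewrite modulusV x1 invr1.
elim: k => // -[|k] IH _.
  have E N : shifted_sum x N r (half_int C 1) = x * tn N.+1 r x^-1 + (-1) ^+ r * tn N r x.
    rewrite /shifted_sum /bisum big_split /= addrA /tn; congr (_ + _).
      rewrite [in RHS]big_nat_recl // mulrDr expr1 mulrA mulfV // mul1r.
      congr (_ + _); rewrite mulr_sumr; apply: eq_bigr => n _.
      have -> : n%:R + half_int C 1 = n.+1%:R - 2^-1 by rewrite /half_int -[n.+1%:R]natr1; ring.
      by rewrite exprS -mulrA mulVKf // exprVn.
    rewrite mulr_sumr; apply: eq_bigr => n _; rewrite mulrCA; congr (_ * _).
    rewrite (_ : - n%:R + _ = - (n%:R - 2^-1)); last by rewrite /half_int; field.
    by rewrite invrNX.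
  apply: (@tends_ext _ (fun N => x * tn N.+1 r x^-1 + (-1) ^+ r * tn N r x)) => //.
  rewrite expr1 (_ : x * kappa x r = x * ti r x^-1 + (-1) ^+ r * ti r x); last first.
    by rewrite /kappa mulrDr -mulrA [x * (_ * _)]mulrCA mulVKf.
  (* In the divergent case the two partial sums differ by the single term 1/(N + 1/2), which tends
     to 0; [kappa 1 1] is 0 as a difference of equal default values. *)
  have [rx|rx] := pselect ((r, x) = (1%N, 1)).
    case: rx => -> ->; rewrite invr1 !mul1r expr1 mulN1r subrr.
    have := @half_int_inv_tends 1 1 id isT (modulus1 R).
    apply: tends_ext => N; rewrite mulN1r mul1r tnS.
    by rewrite addrAC subrr add0r !expr1n.
  have ad : admissible r x by split.
  apply: tendsD; apply: tendsZ; last exact/rated_tends/ti_rated.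
  have := tends_shift 1 (rated_tends (ti_rated (admissibleV ad))).
  by apply: tends_ext => n; rewrite addn1.
have -> : half_int C k.+2 = half_int C k.+1 + 1 by rewrite /half_int -[k.+2%:R]natr1; ring.
apply: (@tends_ext _ (fun N => x * (shifted_sum x N r (half_int C k.+1)
    + x ^- N.+1 * ((N.+1%:R + half_int C k.+1) ^+ r)^-1
    - x ^+ N * ((half_int C k.+1 - N%:R) ^+ r)^-1))) => [N|].
  by rewrite shifted_sumS.
rewrite exprS -mulrA -[x ^+ k.+1 * _]addr0 -[X in x * X]subr0.
apply/tendsZ/tendsB; first apply: tendsD; first exact: IH.
  have := tends_shift k.+1 (half_int_inv_tends (fun n => n - k)%N r0 xV1).
  apply: tends_ext => n; rewrite exprVn; congr (_ ^- _ * (_ ^+ _)^-1); first by lia.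
  by rewrite /half_int -[n.+1%:R]natr1 -[(n + k.+1).+1%:R]natr1 natrD; ring.
(* Only for N > k is the base of the leaving term the negative of a positive half-integer; with N =
   n + k + 1 it is [- half_int n.+1]. *)
apply: (@tends_unshiftn _ _ k.+1).
have := tendsZ ((-1) ^+ r) (half_int_inv_tends (fun n => n + k.+1)%N r0 x1).
rewrite mulr0; apply: tends_ext => n; rewrite mulrCA; congr (_ * _).
rewrite (_ : half_int C k.+1 - _ = - half_int C n.+1).
  by rewrite invrNX.
by rewrite /half_int -[n.+1%:R]natr1 natrD; field.
Qed.

Definition lambda x r : C := Li r x^-1 + (-1) ^+ r * Li r x.

Lemma zsum_tends x r : is_root_of_unity x -> (0 < r)%N ->
  tends (fun N => zsum x N r) (lambda x r).
Proof.
move=> xr r0.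
have E N : zsum x N r = zetan N r x^-1 + (-1) ^+ r * zetan N r x.
  rewrite /zsum /bisum big_split /zetan mulr_sumr /=; congr (_ + _).
    by apply: eq_bigr => n _; rewrite exprVn.
  apply: eq_bigr => n _; rewrite mulrCA; congr (_ * _).
  by rewrite invrNX.
apply: (@tends_ext _ (fun N => zetan N r x^-1 + (-1) ^+ r * zetan N r x)) => //.
have [rx|rx] := pselect ((r, x) = (1%N, 1)).
  case: rx => -> ->; rewrite /lambda invr1 expr1 mulN1r subrr.
  by apply: tends_ext (tends_cst 0) => N; rewrite mulN1r subrr.
have ad : admissible r x by split.
apply: tendsD; first exact/rated_tends/Li_rated/admissibleV.
exact/tendsZ/rated_tends/Li_rated.
Qed.

Lemma PsiS M p z s : Psi M.+1 p z s = Psi M p z s + z ^+ M.+1 / (s + half_int C M.+1) ^+ p.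
Proof. by rewrite /Psi big_nat_recr. Qed.

Lemma Psi0 p z s : Psi 0 p z s = 0 :> C.
Proof. by rewrite /Psi big_geq. Qed.

(** At s = n the denominators are again half-integers, those of indices n + 1 to n + M. *)
Lemma Psi_pos M p z n : z != 0 ->
  Psi M p z n%:R = z ^- n * (tn (n + M) p z - tn n p z).
Proof.
move=> z0; elim: M => [|M IH]; first by rewrite Psi0 addn0 subrr mulr0.
have -> : tn (n + M.+1) p z - tn n p z = (tn (n + M) p z - tn n p z)
    + z ^+ n * (z ^+ M.+1 / half_int C (n + M).+1 ^+ p).
  by rewrite addnS tnS -addnS exprD; ring.
rewrite PsiS IH [in RHS]mulrDr mulKf ?expf_neq0 //.
by rewrite (_ : n%:R + _ = half_int C (n + M).+1) // /half_int -addnS natrD; ring.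
Qed.

(** All bases k - m - 1/2 are negative; the reflection of k to m + 1 - k inverts z and produces
    (-1)^p z^(m+1). *)
Lemma Psi_neg_gt M p z m : z != 0 -> (M <= m)%N ->
  Psi M p z (- m%:R) = (-1) ^+ p * z ^+ m.+1 * (tn m p z^-1 - tn (m - M) p z^-1).
Proof.
move=> z0; elim: M => [|M IH] Mm; first by rewrite Psi0 subn0 subrr mulr0.
rewrite PsiS IH ?(ltnW Mm) //.
have -> : (m - M = (m - M.+1).+1)%N by lia.
rewrite tnS.
have -> : - m%:R + half_int C M.+1 = - half_int C (m - M.+1).+1.
  have e : m%:R = (m - M.+1)%:R + M.+1%:R :> C by rewrite -natrD subnK.
  by rewrite /half_int e -[(m - M.+1).+1%:R]natr1; field.
have -> : z ^+ M.+1 = z ^+ m.+1 * z^-1 ^+ (m - M.+1).+1.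
  rewrite exprVn; apply: (@mulIf _ (z ^+ (m - M.+1).+1)); first by rewrite expf_neq0.
  by rewrite divfK ?expf_neq0 // -exprD; congr (_ ^+ _); lia.
by rewrite invrNX; ring.
Qed.

(** The bases now change sign: the indices k <= m are reflected as before, and those above m give
    [tn (M - m)]. *)
Lemma Psi_neg_le M p z m : z != 0 -> (m <= M)%N ->
  Psi M p z (- m%:R) = z ^+ m * (tn (M - m) p z + (-1) ^+ p * z * tn m p z^-1).
Proof.
move=> z0; elim: M => [|M IH].
  rewrite leqn0 => /eqP ->.
  by rewrite Psi0 /tn !big_geq // mulr0 addr0 mulr0.
rewrite leq_eqVlt => /orP[/eqP ->|mM].
  rewrite Psi_neg_gt // subnn [tn 0 _ _]big_geq // [tn 0 _ _]big_geq // subr0 add0r.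
  by rewrite exprSr; ring.
rewrite PsiS IH // subSn // tnS.
have -> : - m%:R + half_int C M.+1 = half_int C (M - m).+1.
  have e : M%:R = (M - m)%:R + m%:R :> C by rewrite -natrD subnK.
  by rewrite /half_int -[M.+1%:R]natr1 -[(M - m).+1%:R]natr1 e; ring.
have -> : z ^+ M.+1 = z ^+ m * z ^+ (M - m).+1 by rewrite -exprD; congr (_ ^+ _); lia.
ring.
Qed.

End KernelLimits.

Local Ltac abstract_moduli :=
  repeat match goal with H : is_true (_ <= _) |- _ => revert H end;
  clear;
  repeat match goal with |- context [@modulus ?R ?z] =>
    generalize (@modulus R z) end;
  intros.
(* Without the abstraction, lra tries to unify moduli by unfolding them. *)
Local Ltac mlra := abstract_moduli; lra.

(** * Comparison of the two limits *)

Section DoubleLimit.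
Variable R : realType.
Local Notation C := R[i].
Implicit Types (x z l c : C) (u v : nat -> C) (k m n M N p q r : nat) (b : bool).

Definition signed b n : C := if b then - n%:R else n%:R.

(* The limit of [Psi M p z (signed b n)] as M grows. *)
Definition Psi_lim p z b n : C :=
  if b then z ^+ n * (ti p z + (-1) ^+ p * z * tn n p z^-1)
  else z ^- n * (ti p z - tn n p z).

Lemma ler_div_nat (K : R) m n : 0 <= K -> (0 < m)%N -> (m <= n)%N ->
  K / n%:R <= K / m%:R.
Proof.
move=> K0 m0 mn; rewrite ler_wpM2l // lef_pV2 ?posrE ?ltr0n ?ler_nat //.
exact: leq_trans mn.
Qed.

(** For n <= M the error is the tail of one [tn], cut at n + M for a positive argument and at M - n
    for a negative one; the second, weaker rate is used for both. For n > M the value is a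
    difference of two [tn] that are both close to the same limit. *)
Lemma Psi_approx p z : admissible p z -> exists2 K : R, 0 <= K &
  (forall b M n, (n <= M)%N ->
    [/\ modulus (Psi_lim p z b n) <= K, modulus (Psi M p z (signed b n)) <= K
      & modulus (Psi M p z (signed b n) - Psi_lim p z b n) <= K / (M.+1 - n)%:R]) /\
  (forall b M n, (M < n)%N -> modulus (Psi M p z (signed b n)) <= K / (n - M)%:R).
Proof.
move=> ad; have adV := admissibleV ad.
have [p0 zr _] := ad; have z1 := modulus_unity zr; have z0 := root_of_unity_neq0 zr.
have [K1 K10 H1] := rated_bound (ti_rated ad).
have [K2 K20 H2] := rated_bound (ti_rated adV).
set t := ti p z in H1 *; set t' := ti p z^-1 in H2 *.
have T0 := modulus_ge0 t; have T'0 := modulus_ge0 t'.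
have frac (K : R) n : 0 <= K -> K / n.+1%:R <= K.
  by move=> K0; rewrite ler_pdivrMr // ler_peMr // ler1n.
have zk n y : modulus (z ^+ n * y) = modulus y.
  by rewrite modulusM modulusX z1 expr1n mul1r.
have zVk n y : modulus (z ^- n * y) = modulus y.
  by rewrite modulusM modulusV modulusX z1 expr1n invr1 mul1r.
have sk y : modulus ((-1) ^+ p * z * y) = modulus y.
  by rewrite !modulusM modulus_sign z1 !mul1r.
have d1 n : modulus (tn n p z - t) <= K1 by apply: le_trans (H1 n) (frac _ _ K10).
have d2 n : modulus (tn n p z^-1 - t') <= K2 by apply: le_trans (H2 n) (frac _ _ K20).
have b1 n : modulus (tn n p z) <= modulus t + K1.
  by have := modulus_dist (tn n p z) t 0; rewrite !subr0; have := d1 n; mlra.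
have b2 n : modulus (tn n p z^-1) <= modulus t' + K2.
  by have := modulus_dist (tn n p z^-1) t' 0; rewrite !subr0; have := d2 n; mlra.
exists (modulus t + modulus t' + 2 * K1 + 2 * K2); first by mlra.
have Kle (K : R) n : 0 <= K -> K <= modulus t + modulus t' + 2 * K1 + 2 * K2 ->
    K / n%:R <= (modulus t + modulus t' + 2 * K1 + 2 * K2) / n%:R.
  by move=> K0 KK; rewrite ler_wpM2r ?invr_ge0.
split=> b M n nM.
  rewrite /Psi_lim /signed; case: b.
    rewrite Psi_neg_le // -mulrBr !zk -/t.
    have c1 := modulusD (tn (M - n) p z) ((-1) ^+ p * z * tn n p z^-1).
    have c2 := modulusD t ((-1) ^+ p * z * tn n p z^-1).
    rewrite !sk in c1 c2.
    have := b1 (M - n)%N; have := b2 n; split; [mlra | mlra |].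
    rewrite (_ : _ - _ = tn (M - n) p z - t); last by ring.
    apply: le_trans (H1 _) _; rewrite -subSn //; apply: Kle; mlra.
  rewrite Psi_pos // -mulrBr !zVk -/t.
  have c1 := modulusB t (tn n p z); have c2 := modulusB (tn (n + M) p z) (tn n p z).
  have c3 := modulus_dist (tn (n + M) p z) t (tn n p z).
  rewrite (modulus_distC t (tn n p z)) in c1 c3.
  have := d1 n; have := d1 (n + M)%N; split; [rewrite modulus_distC; mlra | mlra |].
  rewrite (_ : _ - _ = tn (n + M) p z - t); last by ring.
  apply: le_trans (H1 _) _.
  have e : K1 / (n + M).+1%:R <= K1 / (M.+1 - n)%:R.
    by apply: ler_div_nat; rewrite ?subn_gt0 // (leq_trans (leq_subr _ _)) // ltnS leq_addl.
  by apply: le_trans e _; apply: Kle; mlra.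
rewrite /signed; case: b.
  rewrite Psi_neg_gt ?(ltnW nM) // modulusM modulusM modulus_sign modulusX z1 expr1n !mul1r.
  have c := modulus_dist (tn n p z^-1) t' (tn (n - M) p z^-1).
  rewrite (modulus_distC t') in c; apply: le_trans c _.
  apply: le_trans (lerD (H2 _) (H2 _)) _.
  apply: le_trans (_ : (K2 + K2) / (n - M)%:R <= _); last by apply: Kle; mlra.
  by rewrite mulrDl lerD //; apply: ler_div_nat => //; lia.
rewrite Psi_pos // zVk.
have c := modulus_dist (tn (n + M) p z) t (tn n p z).
rewrite (modulus_distC t) in c; apply: le_trans c _.
apply: le_trans (lerD (H1 _) (H1 _)) _.
apply: le_trans (_ : (K1 + K1) / (n - M)%:R <= _); last by apply: Kle; mlra.
by rewrite mulrDl lerD //; apply: ler_div_nat => //; lia.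
Qed.

Definition term x p1 x1 p2 x2 q M b n : C :=
  (if b then x ^+ n else x ^- n)
  * (Psi M p1 x1 (signed b n) * Psi M p2 x2 (signed b n) * (signed b n ^+ q)^-1).

Definition term_lim x p1 x1 p2 x2 q b n : C :=
  (if b then x ^+ n else x ^- n)
  * (Psi_lim p1 x1 b n * Psi_lim p2 x2 b n * (signed b n ^+ q)^-1).

(** Cut at the same M as [Psi]: at -n with n > M the truncated function need no longer be close to
    its limit. *)
Definition partial_lim x p1 x1 p2 x2 q M : C :=
  \sum_(1 <= n < M.+1) (term_lim x p1 x1 p2 x2 q false n + term_lim x p1 x1 p2 x2 q true n).

(** The bound 2 is sharpened so that the induction closes: 1/y^2 <= 2/y - 2/(y+1) for y >= 1. *)
Lemma sum_inv_sqr_le J : \sum_(1 <= j < J.+1) (j%:R ^+ 2)^-1 <= 2 - 2 / J.+1%:R :> R.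
Proof.
elim: J => [|J IH]; first by rewrite big_geq // divr1 subrr.
rewrite big_nat_recr //=; apply: le_trans (lerD IH (lexx _)) _.
rewrite -[J.+2%:R]natr1; set y := J.+1%:R.
have y1 : 1 <= y :> R by rewrite ler1n.
rewrite -subr_ge0.
rewrite (_ : _ - _ = (y - 1) / (y ^+ 2 * (y + 1))).
  by rewrite divr_ge0 ?mulr_ge0 ?exprn_ge0 //; lra.
by field; rewrite ?expf_neq0 ?gt_eqF //; lra.
Qed.

Lemma partial_approx x p1 x1 p2 x2 q : modulus x = 1 -> (0 < q)%N ->
  admissible p1 x1 -> admissible p2 x2 ->
  exists2 K : R, 0 <= K & forall M N, (M <= N)%N ->
  modulus (bisum x N (fun s => Psi M p1 x1 s * Psi M p2 x2 s * (s ^+ q)^-1)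
           - partial_lim x p1 x1 p2 x2 q M) <= K * (harmonic_conv R M + M.+1%:R^-1).
Proof.
move=> mx q0 /Psi_approx[K1 K10 [A1 B1]] /Psi_approx[K2 K20 [A2 B2]].
have K12 : 0 <= K1 * K2 by rewrite mulr_ge0.
(* A factor 2 for the two signs of n, and another 2 for the two terms of the product rule when n <=
   M, or for the sum of inverse squares when n > M. *)
exists (4 * (K1 * K2)); first by lra.
move=> M N MN.
pose t := term x p1 x1 p2 x2 q M; pose tl := term_lim x p1 x1 p2 x2 q.
have sgle b n : (0 < n)%N -> modulus (signed b n ^+ q)^-1 <= n%:R^-1.
  move=> n0; have -> : modulus (signed b n ^+ q)^-1 = (n%:R ^+ q)^-1.
    by rewrite modulusV modulusX; case: b; rewrite /signed ?modulusN modulus_nat.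
  rewrite lef_pV2 ?posrE ?exprn_gt0 ?ltr0n //.
  by rewrite -[leLHS]expr1 ler_weXn2l // ler1n.
have xk b n y : modulus ((if b then x ^+ n else x ^- n) * y) = modulus y.
  by case: b; rewrite modulusM ?modulusV modulusX mx expr1n ?invr1 mul1r.
have near b n : (0 < n <= M)%N ->
    modulus (t b n - tl b n) <= 2 * (K1 * K2) * (n%:R^-1 * (M.+1 - n)%:R^-1).
  move=> /andP[n0 nM]; rewrite /t /tl /term /term_lim -mulrBr xk.
  have [a1 a2 a3] := A1 b M n nM; have [c1 c2 c3] := A2 b M n nM.
  move: (Psi M p1 _ _) (Psi_lim p1 _ _ _) a1 a2 a3 => P1 L1 a1 a2 a3.
  move: (Psi M p2 _ _) (Psi_lim p2 _ _ _) c1 c2 c3 => P2 L2 c1 c2 c3.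
  rewrite -mulrBl modulusM.
  rewrite (_ : 2 * _ * _ = (K1 / (M.+1 - n)%:R * K2 + K1 * (K2 / (M.+1 - n)%:R))
    * n%:R^-1); last by ring.
  rewrite ler_pM ?modulus_ge0 ?sgle //.
  rewrite (_ : _ - _ = (P1 - L1) * P2 + L1 * (P2 - L2)); last by ring.
  apply: le_trans (modulusD _ _) _; rewrite !modulusM.
  by rewrite lerD // ler_pM ?modulus_ge0.
(* Each [Psi] contributes 1/(n-M) and the power of s at most 1/n <= 1/(M+1), which is summable
   uniformly in N. *)
have far b n : (M < n)%N ->
    modulus (t b n) <= K1 * K2 * M.+1%:R^-1 * ((n - M)%:R ^+ 2)^-1.
  move=> Mn; rewrite /t /term xk !modulusM.
  have -> : K1 * K2 * M.+1%:R^-1 * ((n - M)%:R ^+ 2)^-1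
    = K1 / (n - M)%:R * (K2 / (n - M)%:R) * M.+1%:R^-1 by rewrite expr2 invfM; ring.
  rewrite ler_pM ?mulr_ge0 ?modulus_ge0 // ?ler_pM ?modulus_ge0 ?B1 ?B2 //.
  apply: le_trans (sgle _ _ _) _; first by lia.
  by rewrite lef_pV2 ?posrE ?ltr0n ?ler_nat //; lia.
have -> : bisum x N (fun s => Psi M p1 x1 s * Psi M p2 x2 s * (s ^+ q)^-1)
    - partial_lim x p1 x1 p2 x2 q M
  = \sum_(1 <= n < M.+1) ((t false n - tl false n) + (t true n - tl true n))
    + \sum_(M.+1 <= n < N.+1) (t false n + t true n).
  rewrite -(big_natB (fun n => t false n + t true n) MN) /partial_lim.
  have -> : \sum_(1 <= n < M.+1) ((t false n - tl false n) + (t true n - tl true n))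
    = \sum_(1 <= n < M.+1) (t false n + t true n)
      - \sum_(1 <= n < M.+1) (tl false n + tl true n).
    by rewrite -sumrB; apply: eq_bigr => n _; ring.
  rewrite /bisum -[\sum_(1 <= n < M.+1) (term_lim _ _ _ _ _ _ _ _ + _)]/
    (\sum_(1 <= n < M.+1) (tl false n + tl true n)).
  rewrite -[\sum_(1 <= n < N.+1) (_ * (Psi _ _ _ _ * _ * _) + _)]/
    (\sum_(1 <= n < N.+1) (t false n + t true n)).
  move: (\sum_(1 <= n < N.+1) _) (\sum_(1 <= n < M.+1) _) (\sum_(1 <= n < M.+1) _).
  by move=> S1 S2 S3; ring.
apply: le_trans (modulusD _ _) _; rewrite mulrDr lerD //.
  apply: le_trans (modulus_sum _ _ _) _; rewrite mulr_sumr.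
  rewrite big_nat_cond [leRHS]big_nat_cond; apply: ler_sum => n.
  rewrite andbT ltnS => nM; apply: le_trans (modulusD _ _) _.
  rewrite (_ : 4 * _ * _ = 2 * (K1 * K2) * (n%:R^-1 * (M.+1 - n)%:R^-1)
    + 2 * (K1 * K2) * (n%:R^-1 * (M.+1 - n)%:R^-1)); last by ring.
  by rewrite lerD // near.
apply: le_trans (modulus_sum _ _ _) _.
apply: le_trans (_ : \sum_(M.+1 <= n < N.+1)
    2 * (K1 * K2 * M.+1%:R^-1) * ((n - M)%:R ^+ 2)^-1 <= _).
  rewrite big_nat_cond [leRHS]big_nat_cond; apply: ler_sum => n.
  rewrite andbT ltnS => /andP[Mn _]; apply: le_trans (modulusD _ _) _.
  rewrite (_ : 2 * _ * _ = K1 * K2 * M.+1%:R^-1 * ((n - M)%:R ^+ 2)^-1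
    + K1 * K2 * M.+1%:R^-1 * ((n - M)%:R ^+ 2)^-1); last by ring.
  by rewrite lerD // far.
rewrite -mulr_sumr (_ : 4 * _ / _ = 2 * (K1 * K2 * M.+1%:R^-1) * 2); last by ring.
rewrite ler_wpM2l ?mulr_ge0 ?invr_ge0 //.
rewrite -{1}[M.+1]add1n big_addn.
rewrite (_ : (N.+1 - M = (N - M).+1)%N); last by rewrite subSn.
under eq_bigr do rewrite addnK.
by apply: le_trans (sum_inv_sqr_le _) _; rewrite gerDl oppr_le0 divr_ge0.
Qed.

Lemma tends_le u l c (e : R) N0 : tends u l ->
  (forall n, (N0 <= n)%N -> modulus (u n - c) <= e) -> modulus (l - c) <= e.
Proof.
move=> ul H; apply/ler_addgt0Pr => d d0; have [N HN] := ul d d0.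
have := HN (maxn N N0) (leq_maxl _ _); have := H (maxn N N0) (leq_maxr _ _).
have := modulus_dist l (u (maxn N N0)) c; rewrite (modulus_distC l (u _)); lra.
Qed.

(** The bound of [partial_approx] is uniform in N >= M, so it passes to N going to infinity and
    gives [B M - partial_lim M] tending to 0. *)
Lemma double_limit x p1 x1 p2 x2 q (B : nat -> C) LA LB :
  modulus x = 1 -> (0 < q)%N -> admissible p1 x1 -> admissible p2 x2 ->
  tends (partial_lim x p1 x1 p2 x2 q) LA ->
  (forall M, tends (fun N => bisum x N
     (fun s => Psi M p1 x1 s * Psi M p2 x2 s * (s ^+ q)^-1)) (B M)) ->
  tends B LB -> LA = LB.
Proof.
move=> mx q0 ad1 ad2 HA HB BL; apply: tends_unique BL.
have [K K0 HK] := partial_approx mx q0 ad1 ad2.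
apply: tends_dist0 HA _.
have h0 : tends (fun M => (harmonic_conv R M)%:C + (1 / M.+1%:R)%:C) 0.
  rewrite -[X in tends _ X]addr0; apply: tendsD; first exact: harmonic_conv_tends.
  exact: tends_invn.
apply: (tends0_bounded h0 K0) => M; rewrite -rmorphD modulus_real.
apply: le_trans (_ : K * (harmonic_conv R M + M.+1%:R^-1) <= _).
  by apply: tends_le (HB M) _ => N; apply: HK.
by rewrite mul1r ler_wpM2l // ler_norm.
Qed.

End DoubleLimit.

(** * Evaluation of both limits *)

Section LimitValues.
Variable R : realType.
Local Notation C := R[i].
Implicit Types (x y z l c : C) (u v : nat -> C) (i j k m n M N p q r P Q : nat).

Lemma partial_lim_tends x p1 x1 p2 x2 q : is_root_of_unity x ->
  admissible p1 x1 -> admissible p2 x2 -> admissible q (x * x1 * x2) ->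
  let X := x * x1 * x2 in
  tends (partial_lim x p1 x1 p2 x2 q)
   (ti p1 x1 * ti p2 x2 * Li q X^-1
    - ti p1 x1 * Stilde [:: (p2, x2)] q X^-1
    - ti p2 x2 * Stilde [:: (p1, x1)] q X^-1
    + Stilde [:: (p1, x1); (p2, x2)] q X^-1
    + ((-1) ^+ q * (ti p1 x1 * ti p2 x2) * Li q X
    + (-1) ^+ q * (ti p1 x1 * ((-1) ^+ p2 * x2)) * Stilde [:: (p2, x2^-1)] q X
    + (-1) ^+ q * (ti p2 x2 * ((-1) ^+ p1 * x1)) * Stilde [:: (p1, x1^-1)] q X
    + (-1) ^+ q * ((-1) ^+ p1 * x1 * ((-1) ^+ p2 * x2))
      * Stilde [:: (p1, x1^-1); (p2, x2^-1)] q X)).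
Proof.
move=> xr ad1 ad2 adX X.
have x0 := root_of_unity_neq0 xr.
have [_ /root_of_unity_neq0 x10 _] := ad1; have [_ /root_of_unity_neq0 x20 _] := ad2.
have adXV := admissibleV adX; have ad1V := admissibleV ad1; have ad2V := admissibleV ad2.
have S1 p z y : admissible p z -> admissible q y ->
    tends (fun M => \sum_(1 <= n < M.+1) tn n p z * (y ^+ n / n%:R ^+ q))
      (Stilde [:: (p, z)] q y).
  move=> a1 a2; have h pz : pz \in [:: (p, z)] -> admissible pz.1 pz.2.
    by rewrite inE => /eqP ->.
  apply: tends_ext (Stilde_tends h a2) => M.
  by apply: eq_bigr => n _; rewrite big_seq1 -mulrA [_^-1 * _]mulrC.
have S2 pa za pb zb y : admissible pa za -> admissible pb zb -> admissible q y ->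
    tends (fun M => \sum_(1 <= n < M.+1) tn n pa za * tn n pb zb * (y ^+ n / n%:R ^+ q))
      (Stilde [:: (pa, za); (pb, zb)] q y).
  move=> a1 a2 a3.
  have h pz : pz \in [:: (pa, za); (pb, zb)] -> admissible pz.1 pz.2.
    by rewrite !inE => /orP[] /eqP ->.
  apply: tends_ext (Stilde_tends h a3) => M.
  by apply: eq_bigr => n _; rewrite big_cons big_seq1 -mulrA [_^-1 * _]mulrC.
have S0 y : admissible q y ->
    tends (fun M => \sum_(1 <= n < M.+1) (y ^+ n / n%:R ^+ q)) (Li q y).
  by move=> a1; have := rated_tends (Li_rated a1); apply: tends_ext.
have L := tendsD (tendsD (tendsB (tendsB (tendsZ (ti p1 x1 * ti p2 x2) (S0 _ adXV))
  (tendsZ (ti p1 x1) (S1 _ _ _ ad2 adXV))) (tendsZ (ti p2 x2) (S1 _ _ _ ad1 adXV)))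
  (S2 _ _ _ _ _ ad1 ad2 adXV))
 (tendsD (tendsD (tendsD (tendsZ ((-1) ^+ q * (ti p1 x1 * ti p2 x2)) (S0 _ adX))
  (tendsZ ((-1) ^+ q * (ti p1 x1 * ((-1) ^+ p2 * x2))) (S1 _ _ _ ad2V adX)))
  (tendsZ ((-1) ^+ q * (ti p2 x2 * ((-1) ^+ p1 * x1))) (S1 _ _ _ ad1V adX)))
  (tendsZ ((-1) ^+ q * ((-1) ^+ p1 * x1 * ((-1) ^+ p2 * x2)))
    (S2 _ _ _ _ _ ad1V ad2V adX))).
apply: tends_ext L => M; rewrite /partial_lim !mulr_sumr -!sumrB -!big_split /=.
apply: eq_bigr => n _; rewrite /term_lim /Psi_lim /signed invrNX.
have -> : X^-1 ^+ n = x ^- n * x1 ^- n * x2 ^- n by rewrite /X !invfM !exprMn !exprVn.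
have -> : X ^+ n = x ^+ n * x1 ^+ n * x2 ^+ n by rewrite /X !exprMn.
move: (tn n p1 x1) (tn n p2 x2) (tn n p1 x1^-1) (tn n p2 x2^-1) => t1 t2 t1' t2'.
move: (ti p1 x1) (ti p2 x2) ((n%:R ^+ q)^-1) => T1 T2 D.
move: (x ^- n) (x1 ^- n) (x2 ^- n) => a a1 a2.
move: (x ^+ n) (x1 ^+ n) (x2 ^+ n) ((-1) ^+ q) ((-1) ^+ p1) ((-1) ^+ p2).
by move=> b b1 b2 s s1 s2; ring.
Qed.

Lemma offdiag_sum k M P z : z != 0 -> (0 < k <= M)%N ->
  \sum_(1 <= l < M.+1 | l != k) z ^+ l / (l%:R - k%:R) ^+ P
  = z ^+ k * (zetan (M - k) P z + (-1) ^+ P * zetan k.-1 P z^-1).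
Proof.
move=> z0 /andP[k0 kM].
rewrite big_mkcond (big_cat_nat (n := k)) //=; last by rewrite ltnW.
rewrite (big_ltn (m := k)) // eqxx /= add0r addrC mulrDr; congr (_ + _).
  rewrite -[k.+1]addn1 addnC big_addn subSn // /zetan mulr_sumr.
  apply: eq_big_nat => l /andP[l0 _].
  rewrite (_ : _ != _); last by lia.
  by rewrite natrD addrK exprD mulrA [z ^+ k * _]mulrC.
rewrite big_nat_rev /= /zetan prednK // !mulr_sumr.
apply: eq_big_nat => l /andP[l0 lk]; rewrite add1n subSS.
rewrite (_ : _ != _); last by lia.
have -> : (k - l)%:R - k%:R = - l%:R :> C by rewrite natrB ?(ltnW lk) //; ring.
rewrite invrNX exprB ?(ltnW lk) ?unitfE // exprVn.
move: (z ^- l) ((l%:R ^+ P)^-1) => a b; ring.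
Qed.

Definition offdiag M y Q z P : C :=
  \sum_(1 <= k < M.+1) y ^+ k / half_int C k ^+ Q
    * \sum_(1 <= l < M.+1 | l != k) z ^+ l / (l%:R - k%:R) ^+ P.

(** The inner sum splits at l = k. The part l > k is cut at M - k and tends to Li, which factors out
    and leaves ti. The part l < k has k - 1 terms whatever M is, so it stays inside the outer sum
    and gives R. *)
Lemma offdiag_tends y Q z P : admissible P z -> admissible Q (y * z) ->
  tends (fun M => offdiag M y Q z P)
    (Li P z * ti Q (y * z)
     + (-1) ^+ P * (y * z * Rsum [:: (P, z^-1)] Q (y * z))).
Proof.
move=> aP aQ; have [_ /root_of_unity_neq0 z0 _] := aP.
have [Q0 /modulus_unity yz1 _] := aQ.
have t0 := tendsZ (Li P z) (rated_tends (ti_rated aQ)).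
have tR : tends (fun N => \sum_(1 <= k < N.+1)
    zetan k.-1 P z^-1 * ((y * z) ^+ k / half_int C k ^+ Q))
    (y * z * Rsum [:: (P, z^-1)] Q (y * z)).
  have h pz : pz \in [:: (P, z^-1)] -> admissible pz.1 pz.2.
    by rewrite inE => /eqP ->; apply: admissibleV.
  apply: tends_ext (Rsum_tends h aQ) => M.
  by apply: eq_bigr => k _; rewrite big_seq1.
have tc : tends (fun M => \sum_(1 <= k < M.+1)
    ((y * z) ^+ k / half_int C k ^+ Q) * (zetan (M - k) P z - Li P z)) 0.
  apply: (conv_tends0 (K := 2 ^+ Q) _ (Li_rated aP)) => [|k k0]; first by rewrite exprn_ge0.
  by rewrite modulusM modulusX yz1 expr1n mul1r; apply: half_int_inv_le.
have := tendsD (tendsD tc t0) (tendsZ ((-1) ^+ P) tR); rewrite add0r.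
apply: tends_ext => M; rewrite /offdiag /tn !mulr_sumr -!big_split /=.
apply: eq_big_nat => k /andP[k0 kM]; rewrite offdiag_sum ?k0 // exprMn -/(half_int C k).
move: (zetan _ _ _) (zetan _ _ _) (Li _ _) ((half_int C k ^+ Q)^-1) => a b l h.
ring.
Qed.

Lemma taylor_inv_half k q j : taylor_inv (- half_int C k) q j
  = (-1) ^+ q * 'C(q + j - 1, j)%:R / half_int C k ^+ (q + j).
Proof.
rewrite /taylor_inv invrNX exprD.
have e : (-1) ^+ j * (-1) ^+ j = 1 :> C by rewrite -exprMn mulrNN mulr1 expr1n.
move: (_^-1) => h.
transitivity (((-1) ^+ j * (-1) ^+ j) * ((-1) ^+ q * 'C(q + j - 1, j)%:R * h)).
  by ring.
by rewrite e mul1r.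
Qed.

Definition pole_lim x (kap : nat -> C) p1 x1 p2 x2 q : C :=
  \sum_(i < p1) \sum_(j < p1 - i) (-1) ^+ i * 'C(p2 + i - 1, i)%:R
    * ((-1) ^+ q * 'C(q + j - 1, j)%:R) * kap (p1 - i - j)%N
    * (Li (p2 + i) x2 * ti (q + j) (x * x1 * x2)
       + (-1) ^+ (p2 + i)
         * (x * x1 * x2 * Rsum [:: ((p2 + i)%N, x2^-1)] (q + j) (x * x1 * x2))).

Lemma pole_sum_tends x (kap : nat -> C) p1 x1 p2 x2 q :
  admissible p2 x2 -> admissible q (x * x1 * x2) ->
  tends (fun M => pole_sum (fun r k => x ^+ k * kap r) M p1 x1 p2 x2 q)
    (pole_lim x kap p1 x1 p2 x2 q).
Proof.
move=> a2 aX.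
have E M : pole_sum (fun r k => x ^+ k * kap r) M p1 x1 p2 x2 q
  = \sum_(i < p1) \sum_(j < p1 - i) (-1) ^+ i * 'C(p2 + i - 1, i)%:R
    * ((-1) ^+ q * 'C(q + j - 1, j)%:R) * kap (p1 - i - j)%N
    * offdiag M (x * x1) (q + j) x2 (p2 + i).
  rewrite /pole_sum.
  under eq_bigr do under eq_bigr do rewrite mulr_sumr.
  under eq_bigr do rewrite exchange_big /=.
  rewrite exchange_big /=; apply: eq_bigr => i _.
  under [RHS]eq_bigr do rewrite /offdiag mulr_sumr.
  rewrite [RHS]exchange_big /=; apply: eq_bigr => k _.
  under eq_bigr do rewrite mulr_sumr mulr_sumr.
  rewrite exchange_big /=; apply: eq_bigr => j _.
  rewrite [RHS]mulrA [RHS]mulr_sumr; apply: eq_bigr => l _.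
  rewrite half_intB taylor_inv_half {1}/taylor_inv exprMn.
  move: (_^-1) (_^-1) => a b; ring.
apply: (tends_ext (fun M => esym (E M))).
apply: tends_sum => i _; apply: tends_sum => j _; apply/tendsZ.
by apply: offdiag_tends; apply: admissible_add.
Qed.

Definition diag_lim (kap : nat -> C) p X q : C :=
  \sum_(j < p) (-1) ^+ q * 'C(q + j - 1, j)%:R * kap (p - j)%N * ti (q + j) X.

Lemma diag_sum_tends x (kap : nat -> C) p z q : admissible q (x * z) ->
  tends (fun M => diag_sum (fun r k => x ^+ k * kap r) M p z q)
    (diag_lim kap p (x * z) q).
Proof.
move=> aX.
have E M : diag_sum (fun r k => x ^+ k * kap r) M p z q
  = \sum_(j < p) (-1) ^+ q * 'C(q + j - 1, j)%:R * kap (p - j)%N * tn M (q + j) (x * z).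
  rewrite /diag_sum; under eq_bigr do rewrite mulr_sumr.
  rewrite exchange_big /=; apply: eq_bigr => j _; rewrite /tn mulr_sumr.
  apply: eq_bigr => k _; rewrite taylor_inv_half exprMn -/(half_int C k).
  move: (_^-1) => a; ring.
apply: (tends_ext (fun M => esym (E M))).
apply: tends_sum => j _; apply/tendsZ/rated_tends/ti_rated; exact: admissible_add.
Qed.

Definition conv_lim p1 x1 p2 x2 n : C :=
  \sum_(i < n.+1) (-1) ^+ n * 'C(p1 + i - 1, i)%:R * 'C(p2 + (n - i) - 1, n - i)%:R
    * (ti (p1 + i) x1 * ti (p2 + (n - i)) x2).

Lemma conv_sum_tends p1 x1 p2 x2 n : admissible p1 x1 -> admissible p2 x2 ->
  tends (fun M => conv_sum M p1 x1 p2 x2 n) (conv_lim p1 x1 p2 x2 n).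
Proof.
move=> a1 a2.
have E M : conv_sum M p1 x1 p2 x2 n
  = \sum_(i < n.+1) (-1) ^+ n * 'C(p1 + i - 1, i)%:R * 'C(p2 + (n - i) - 1, n - i)%:R
    * (tn M (p1 + i) x1 * tn M (p2 + (n - i)) x2).
  rewrite /conv_sum /taylor_conv.
  under eq_bigr do under eq_bigr do rewrite mulr_sumr.
  under eq_bigr do rewrite exchange_big /=.
  rewrite exchange_big /=; apply: eq_bigr => i _.
  rewrite /tn mulr_suml mulr_sumr; apply: eq_bigr => k _.
  rewrite !mulr_sumr; apply: eq_bigr => l _.
  rewrite -!/(half_int C _) /taylor_inv.
  have -> : (-1) ^+ n = (-1) ^+ i * (-1) ^+ (n - i) :> C.
    by rewrite -exprD subnKC // -ltnS.
  move: (_^-1) (_^-1) => a b; ring.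
apply: (tends_ext (fun M => esym (E M))).
apply: tends_sum => i _; apply/tendsZ/tendsM; apply/rated_tends/ti_rated;
  exact: admissible_add.
Qed.

Lemma tends_sum_nat m n (A : pred nat) (f : nat -> nat -> C) (g : nat -> C) :
  (forall k, (m <= k < n)%N -> tends (f k) (g k)) ->
  tends (fun N => \sum_(m <= k < n | A k) f k N) (\sum_(m <= k < n | A k) g k).
Proof.
move=> fg; rewrite big_nat_cond.
apply: tends_ext (_ : tends (fun N => \sum_(m <= k < n | (m <= k < n)%N && A k) f k N) _).
  by move=> N; rewrite [in RHS]big_nat_cond.
by apply: tends_sum => k /andP[/fg].
Qed.

Lemma bisum_tends x M p1 x1 p2 x2 q : is_root_of_unity x ->
  (0 < p1 + p2)%N -> (0 < q)%N ->
  let T r k := x ^+ k * kappa x r in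
  tends (fun N => bisum x N (fun s => Psi M p1 x1 s * Psi M p2 x2 s * (s ^+ q)^-1))
   (pole_sum T M p1 x1 p2 x2 q + pole_sum T M p2 x2 p1 x1 q
    + diag_sum T M (p1 + p2) (x1 * x2) q
    - conv_sum M p1 x1 p2 x2 q
    + \sum_(j < q) conv_sum M p1 x1 p2 x2 j * lambda x (q - j)).
Proof.
move=> xr pp q0 T.
have tT r k : (0 < r)%N -> (0 < k)%N ->
    tends (fun N => shifted_sum x N r (half_int C k)) (T r k).
  by move=> r0 k0; apply: shifted_sum_tends.
have tpole pa xa pb xb : tends (fun N =>
    pole_sum (fun r k => shifted_sum x N r (half_int C k)) M pa xa pb xb q)
    (pole_sum T M pa xa pb xb q).
  apply: tends_sum_nat => k /andP[k0 _]; apply: tends_sum => l _; apply: tendsZ.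
  apply: tends_sum => i _; apply: tendsZ; apply: tends_sum => j _; apply: tendsZ.
  by apply: tT => //; rewrite !subn_gt0 ltn_ord.
apply: (tends_ext (fun N => esym (finite_identity x N M x1 x2 pp q0))).
apply: tendsD; first apply: tendsB; first apply: tendsD; first exact: tendsD.
- apply: tends_sum_nat => k /andP[k0 _]; apply/tendsZ/tends_sum => j _; apply: tendsZ.
  by apply: tT => //; rewrite subn_gt0 ltn_ord.
- exact: tends_cst.
apply: tends_sum => j _; apply: tendsZ; apply: zsum_tends => //.
by rewrite subn_gt0 ltn_ord.
Qed.

(** The theorem multiplied by x1 x2 and with its sums not yet reindexed. *)
Lemma limit_identity x p1 x1 p2 x2 q : is_root_of_unity x ->
  admissible p1 x1 -> admissible p2 x2 -> admissible q (x * x1 * x2) ->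
  let X := x * x1 * x2 in
  ti p1 x1 * ti p2 x2 * Li q X^-1
    - ti p1 x1 * Stilde [:: (p2, x2)] q X^-1
    - ti p2 x2 * Stilde [:: (p1, x1)] q X^-1
    + Stilde [:: (p1, x1); (p2, x2)] q X^-1
    + ((-1) ^+ q * (ti p1 x1 * ti p2 x2) * Li q X
    + (-1) ^+ q * (ti p1 x1 * ((-1) ^+ p2 * x2)) * Stilde [:: (p2, x2^-1)] q X
    + (-1) ^+ q * (ti p2 x2 * ((-1) ^+ p1 * x1)) * Stilde [:: (p1, x1^-1)] q X
    + (-1) ^+ q * ((-1) ^+ p1 * x1 * ((-1) ^+ p2 * x2))
      * Stilde [:: (p1, x1^-1); (p2, x2^-1)] q X)
  = pole_lim x (kappa x) p1 x1 p2 x2 q + pole_lim x (kappa x) p2 x2 p1 x1 q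
    + diag_lim (kappa x) (p1 + p2) X q - conv_lim p1 x1 p2 x2 q
    + \sum_(j < q) conv_lim p1 x1 p2 x2 j * lambda x (q - j).
Proof.
move=> xr a1 a2 aX X; have [p10 _ _] := a1; have [q0 _ _] := aX.
have aX' : admissible q (x * x2 * x1) by rewrite mulrAC.
have aXm : admissible q (x * (x1 * x2)) by rewrite mulrA.
apply: (double_limit (modulus_unity xr) q0 a1 a2 (partial_lim_tends xr a1 a2 aX)
  (fun M => bisum_tends M x1 x2 xr (ltn_addr p2 p10) q0)).
apply: tendsD; first apply: tendsB; first apply: tendsD; first apply: tendsD.
- exact: pole_sum_tends.
- exact: pole_sum_tends.
- by rewrite /X -mulrA; apply: diag_sum_tends.
- exact: conv_sum_tends.
apply: tends_sum => j _; apply: tendsM; last exact: tends_cst.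
exact: conv_sum_tends.
Qed.

End LimitValues.

(** * Rewriting the limits with the indices of the theorem *)

Section Reindexing.
Variable R : realType.
Local Notation C := R[i].
Implicit Types (x X c : C) (i j k m n p q s : nat).

(** The substitution i = k2, j = p - 1 - k1 - k2; then p - i - j = k1 + 1 is the order at which
    [kappa] appears. *)
Lemma sum_triangle (V : nmodType) p (F : nat -> nat -> V) :
  \sum_(k1 < p) \sum_(k2 < p | (k1 + k2 <= p - 1)%N) F k2 (p - 1 - k1 - k2)%N
  = \sum_(i < p) \sum_(j < p - i) F i j.
Proof.
rewrite (exchange_big_dep xpredT) //=; apply: eq_bigr => i _.
rewrite (eq_bigl (fun k1 : 'I_p => (k1 < p - i)%N)); last first.
  by move=> k1 /=; have := ltn_ord i; have := ltn_ord k1; lia.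
rewrite -(big_ord_widen p (fun k1 => F i (p - 1 - k1 - i)%N) (leq_subr i p)).
rewrite (reindex_inj rev_ord_inj) /=; apply: eq_bigr => j _; congr (F _ _).
by have := ltn_ord j; lia.
Qed.

Lemma sum_add_eq (V : nmodType) n m s (G : nat -> V) : (m <= s < m + n)%N ->
  \sum_(k < n | (m + k == s)%N) G k = G (s - m)%N.
Proof.
move=> /andP[ms sn]; have kn : (s - m < n)%N by lia.
rewrite (big_pred1 (Ordinal kn)) // => k; rewrite /= -val_eqE /=; lia.
Qed.

Lemma bin_swap p i : (0 < p)%N -> 'C(p + i - 1, i) = 'C(i + p - 1, p - 1).
Proof.
move=> p0; rewrite -bin_sub; last by lia.
by rewrite addnC; congr ('C(_, _)); lia.
Qed.

Lemma kappaS x k : x != 0 ->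
  kappa x k.+1 = - (x^-1 * ((-1) ^+ k * ti k.+1 x - x * ti k.+1 x^-1)).
Proof. by move=> x0; rewrite /kappa exprS; move: (ti _ _) (ti _ _) => a b; field. Qed.

Lemma lambdaS x k : lambda x k.+1 = - ((-1) ^+ k * Li k.+1 x - Li k.+1 x^-1).
Proof. by rewrite /lambda exprS; move: (Li _ _) (Li _ _) => a b; ring. Qed.

(** The prefactor is (x1 x2)^-1 written through X and x, which is symmetric in the indices 1 and 2,
    so that one statement serves both permutations. *)
Lemma pole_limE x X p1 x1 p2 x2 q : x != 0 -> X != 0 -> (0 < p2)%N -> (0 < q)%N ->
  x * x1 * x2 = X ->
  X^-1 * x * pole_lim x (kappa x) p1 x1 p2 x2 q
  = - ((-1) ^+ q * \sum_(k1 < p1) \sum_(k2 < p1 | (k1 + k2 <= p1 - 1)%N)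
        'C(p1 + q - k1 - k2 - 2, q - 1)%:R * 'C(k2 + p2 - 1, p2 - 1)%:R
        * ((-1) ^+ k1 * ti k1.+1 x - x * ti k1.+1 x^-1)
        * ((-1) ^+ k2 * X^-1 * Li (k2 + p2) x2 * ti (q + p1 - k1 - k2 - 1) X
           + (-1) ^+ p2 * Rsum [:: ((k2 + p2)%N, x2^-1)] (q + p1 - k1 - k2 - 1) X)).
Proof.
move=> x0 X0 p20 q0 hX; rewrite /pole_lim hX.
rewrite -(@sum_triangle _ p1 (fun i j => (-1) ^+ i * 'C(p2 + i - 1, i)%:R
    * ((-1) ^+ q * 'C(q + j - 1, j)%:R) * kappa x (p1 - i - j)
    * (Li (p2 + i) x2 * ti (q + j) X
       + (-1) ^+ (p2 + i) * (X * Rsum [:: ((p2 + i)%N, x2^-1)] (q + j) X)))).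
rewrite !mulr_sumr -sumrN; apply: eq_bigr => k1 _.
rewrite !mulr_sumr -sumrN; apply: eq_bigr => k2 hk.
have k1p := ltn_ord k1.
have -> : (p1 - k2 - (p1 - 1 - k1 - k2) = k1.+1)%N by lia.
have -> : (q + p1 - k1 - k2 - 1 = q + (p1 - 1 - k1 - k2))%N by lia.
rewrite (bin_swap k2 p20) (bin_swap _ q0).
have -> : (p1 - 1 - k1 - k2 + q - 1 = p1 + q - k1 - k2 - 2)%N by lia.
rewrite (addnC p2 k2) kappaS // exprD.
have e : (-1) ^+ k2 * (-1) ^+ k2 = 1 :> C by rewrite -exprMn mulrNN mulr1 expr1n.
move: (Li _ _) (Rsum _ _ _) (ti _ X) ('C(_, _)%:R) ('C(_, _)%:R) => L S t b1 b2.
move: (_ * _ - _) ((-1) ^+ q) ((-1) ^+ p2) => K sq sp.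
transitivity (- (sq * (b2 * b1 * K * ((-1) ^+ k2 * X^-1 * L * t
  + ((-1) ^+ k2 * (-1) ^+ k2) * sp * S)))).
  by field; rewrite x0 X0.
by rewrite e; ring.
Qed.

Lemma diag_limE x X p q : x != 0 -> (0 < q)%N ->
  X^-1 * x * diag_lim (kappa x) p X q
  = - ((-1) ^+ q * X^-1 * \sum_(k < p) 'C(p + q - k - 2, q - 1)%:R
      * ((-1) ^+ k * ti k.+1 x - x * ti k.+1 x^-1) * ti (p + q - k - 1) X).
Proof.
move=> x0 q0; rewrite /diag_lim (reindex_inj rev_ord_inj) /=.
rewrite !mulr_sumr -sumrN; apply: eq_bigr => k _; have kp := ltn_ord k.
have -> : (p - (p - k.+1) = k.+1)%N by lia.
have -> : (p + q - k - 1 = q + (p - k.+1))%N by lia.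
rewrite (bin_swap _ q0).
have -> : (p - k.+1 + q - 1 = p + q - k - 2)%N by lia.
rewrite kappaS //; move: (ti _ X) ('C(_, _)%:R) (_ * _ - _) (X^-1) => t b K Y.
by field.
Qed.

Lemma conv_limE c p1 x1 p2 x2 q : (0 < p1)%N -> (0 < p2)%N ->
  c * conv_lim p1 x1 p2 x2 q
  = \sum_(k1 < q.+1) \sum_(k2 < q.+1 | (k1 + k2 == q)%N)
      (-1) ^+ q * 'C(p1 + k1 - 1, p1 - 1)%:R * 'C(p2 + k2 - 1, p2 - 1)%:R
      * c * ti (p1 + k1) x1 * ti (p2 + k2) x2.
Proof.
move=> p10 p20; rewrite /conv_lim mulr_sumr; apply: eq_bigr => k1 _.
rewrite (@sum_add_eq _ _ _ _ (fun k2 => (-1) ^+ q * 'C(p1 + k1 - 1, p1 - 1)%:R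
  * 'C(p2 + k2 - 1, p2 - 1)%:R * c * ti (p1 + k1) x1 * ti (p2 + k2) x2)); last first.
  by have := ltn_ord k1; lia.
by rewrite (bin_swap _ p10) (bin_swap _ p20) (addnC k1) (addnC (q - k1)%N); ring.
Qed.

Lemma conv_lambda_limE c x p1 x1 p2 x2 q : (0 < p1)%N -> (0 < p2)%N ->
  c * \sum_(j < q) conv_lim p1 x1 p2 x2 j * lambda x (q - j)
  = - \sum_(k1 < q) \sum_(k2 < q) \sum_(k3 < q | (k1 + k2 + k3 == q - 1)%N)
      ((-1) ^+ k1 * Li k1.+1 x - Li k1.+1 x^-1) * (-1) ^+ (k2 + k3)
      * 'C(k2 + p1 - 1, p1 - 1)%:R * 'C(k3 + p2 - 1, p2 - 1)%:R
      * ti (k2 + p1) x1 * ti (k3 + p2) x2 * c.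
Proof.
move=> p10 p20; rewrite (reindex_inj rev_ord_inj) /= mulr_sumr -sumrN.
apply: eq_bigr => k1 _; have k1q := ltn_ord k1.
have -> : (q - (q - k1.+1) = k1.+1)%N by lia.
pose G k2 k3 : C := ((-1) ^+ k1 * Li k1.+1 x - Li k1.+1 x^-1) * (-1) ^+ (k2 + k3)
      * 'C(k2 + p1 - 1, p1 - 1)%:R * 'C(k3 + p2 - 1, p2 - 1)%:R
      * ti (k2 + p1) x1 * ti (k3 + p2) x2 * c.
(* For fixed k1 the constraint determines k3 and limits k2 to q - 1 - k1, the range of the sum in
   [conv_lim]. *)
have -> : \sum_(k2 < q) \sum_(k3 < q | (k1 + k2 + k3 == q - 1)%N) G k2 k3
    = \sum_(k2 < (q - k1.+1).+1) G k2 (q - k1.+1 - k2)%N.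
  have qk : ((q - k1.+1).+1 <= q)%N by lia.
  rewrite (big_ord_widen q (fun k2 => G k2 (q - k1.+1 - k2)%N) qk) [RHS]big_mkcond /=.
  apply: eq_bigr => k2 _; case: ifP => hk.
    rewrite (sum_add_eq (m := (k1 + k2)%N) (G k2)); last by lia.
    by congr (G _ _); lia.
  by rewrite big_pred0 // => k3; lia.
rewrite lambdaS /conv_lim mulr_suml mulr_sumr -sumrN; apply: eq_bigr => k2 _.
have k2q := ltn_ord k2; rewrite /G subnKC; last by lia.
rewrite (bin_swap _ p10) (bin_swap _ p20) (addnC p1) (addnC p2).
move: (_ * _ - _) (ti _ _) (ti _ _) => K t1 t2; ring.
Qed.

End Reindexing.

Theorem theorem4p3 (R : realType) (x x1 x2 : R[i]) (p1 p2 q : nat)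
  (hx : is_root_of_unity x) (hx1 : is_root_of_unity x1) (hx2 : is_root_of_unity x2)
  (hp1 : (1 <= p1)%N) (hp2 : (1 <= p2)%N) (hq : (1 <= q)%N)
  (hpx1 : (p1, x1) <> (1%N, 1)) (hpx2 : (p2, x2) <> (1%N, 1))
  (hqX : (q, x * x1 * x2) <> (1%N, 1)) :
  let X := x * x1 * x2 in
  (x1 * x2)^-1 * Stilde [:: (p1, x1); (p2, x2)] q X^-1
  + (-1) ^+ (p1 + p2 + q) * Stilde [:: (p1, x1^-1); (p2, x2^-1)] q X
  =
  - (x1 * x2)^-1 * ti p1 x1 * ti p2 x2 * Li q X^-1
  - (-1) ^+ q * (x1 * x2)^-1 * ti p1 x1 * ti p2 x2 * Li q X
  + sum_sigma p1 x1 p2 x2 (fun ps1 xs1 ps2 xs2 =>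
      (x1 * x2)^-1 * ti ps1 xs1 * Stilde [:: (ps2, xs2)] q X^-1)
  - (-1) ^+ q * sum_sigma p1 x1 p2 x2 (fun ps1 xs1 ps2 xs2 =>
      (-1) ^+ ps2 * xs1^-1 * ti ps1 xs1 * Stilde [:: (ps2, xs2^-1)] q X)
  - (-1) ^+ q * X^-1 * (\sum_(k < p1 + p2)
      'C(p1 + p2 + q - k - 2, q - 1)%:R
      * ((-1) ^+ k * ti k.+1 x - x * ti k.+1 x^-1)
      * ti (p1 + p2 + q - k - 1) X)
  - (-1) ^+ q * sum_sigma p1 x1 p2 x2 (fun ps1 xs1 ps2 xs2 =>
      \sum_(k1 < ps1) \sum_(k2 < ps1 | (k1 + k2 <= ps1 - 1)%N)
        'C(ps1 + q - k1 - k2 - 2, q - 1)%:R * 'C(k2 + ps2 - 1, ps2 - 1)%:R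
        * ((-1) ^+ k1 * ti k1.+1 x - x * ti k1.+1 x^-1)
        * ((-1) ^+ k2 * X^-1 * Li (k2 + ps2) xs2
             * ti (q + ps1 - k1 - k2 - 1) X
           + (-1) ^+ ps2
             * Rsum [:: ((k2 + ps2)%N, xs2^-1)] (q + ps1 - k1 - k2 - 1) X))
  - (\sum_(k1 < q.+1) \sum_(k2 < q.+1 | (k1 + k2 == q)%N)
      (-1) ^+ q * 'C(p1 + k1 - 1, p1 - 1)%:R * 'C(p2 + k2 - 1, p2 - 1)%:R
      * (x1 * x2)^-1 * ti (p1 + k1) x1 * ti (p2 + k2) x2)
  - (\sum_(k1 < q) \sum_(k2 < q) \sum_(k3 < q | (k1 + k2 + k3 == q - 1)%N)
      ((-1) ^+ k1 * Li k1.+1 x - Li k1.+1 x^-1) * (-1) ^+ (k2 + k3)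
      * 'C(k2 + p1 - 1, p1 - 1)%:R * 'C(k3 + p2 - 1, p2 - 1)%:R
      * ti (k2 + p1) x1 * ti (k3 + p2) x2 * (x1 * x2)^-1).
Proof.
move=> X.
have a1 : admissible p1 x1 by split.
have a2 : admissible p2 x2 by split.
have aX : admissible q X by split=> //; do 2?apply: root_of_unityM.
have x0 := root_of_unity_neq0 hx; have x10 := root_of_unity_neq0 hx1.
have x20 := root_of_unity_neq0 hx2.
have X0 : X != 0 by rewrite /X !mulf_neq0.
have cE : (x1 * x2)^-1 = X^-1 * x by rewrite /X; field; rewrite x0 x10 x20.
have E := limit_identity hx a1 a2 aX.
rewrite -/X in E.
have P12 := pole_limE p1 x0 X0 hp2 hq (erefl X : x * x1 * x2 = X).
have P21 := pole_limE p2 x0 X0 hp1 hq (mulrAC x x2 x1 : x * x2 * x1 = X).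
have Dg := diag_limE X (p1 + p2) x0 hq.
have Cv := conv_limE (x1 * x2)^-1 x1 x2 q hp1 hp2.
have Cl := conv_lambda_limE (x1 * x2)^-1 x x1 x2 q hp1 hp2.
rewrite -cE in P12 P21 Dg; rewrite /sum_sigma.
set U := (\sum_(k1 < p1) _) in P12 *; set V := (\sum_(k1 < p2) _) in P21 *.
set W := (\sum_(k < p1 + p2) _) in Dg *; set Z := (\sum_(k1 < q.+1) _) in Cv *.
set Y' := (\sum_(j < q) _ * _) in E Cl; set Y := (\sum_(k1 < q) _) in Cl *.
have {}E := congr1 (fun t => (x1 * x2)^-1 * t) E.
rewrite /= [in RHS]mulrDr [in RHS]mulrBr !mulrDr in E.
rewrite P12 P21 Dg Cv Cl in E.
move: E; clearbody U V W Z Y; clear Y' P12 P21 Dg Cv Cl cE; rewrite !exprD.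
move: (ti p1 x1) (ti p2 x2) (Li q X) (Li q X^-1) => T1 T2 L L'.
move: (Stilde [:: (p1, x1); (p2, x2)] q X^-1)
  (Stilde [:: (p1, x1^-1); (p2, x2^-1)] q X) => S12 S12'.
move: (Stilde [:: (p1, x1)] q X^-1) (Stilde [:: (p2, x2)] q X^-1) => S1 S2.
move: (Stilde [:: (p1, x1^-1)] q X) (Stilde [:: (p2, x2^-1)] q X) => S1' S2'.
move: ((-1) ^+ q) ((-1) ^+ p1) ((-1) ^+ p2) X^-1 => sq s1 s2 Y' E.
(* All terms of the left side of [E] except the two with S~_{p1,p2;q} are added to both sides: the
   left becomes that of [E], and on the right only the pole contributions remain. *)
apply: (addrI ((x1 * x2)^-1 * (T1 * T2 * L') - (x1 * x2)^-1 * (T1 * S2)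
  - (x1 * x2)^-1 * (T2 * S1) + (x1 * x2)^-1 * (sq * (T1 * T2) * L)
  + x1^-1 * (sq * (T1 * s2) * S2') + x2^-1 * (sq * (T2 * s1) * S1'))).
transitivity (- (sq * U) - sq * V - sq * Y' * W - Z - Y); last by ring.
by rewrite -E; field; rewrite x10 x20.
Qed.
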